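(* Let $(A,I)$ be a dp-minimal profinite group with $A$ abelian. Then either $A$ has an open subgroup which is a direct product of countably many copies of $\mathbb{F}_p$ for some prime $p$, or $A\cong\prod_p\mathbb{Z}_p^{\alpha_p}\times A_p$ (product over all primes $p$), where $\alpha_p<\omega$ and $A_p$ is a finite abelian $p$-group for each prime $p$.
   Context: A fundamental system of open subgroups of a profinite group $G$ is a family $\{K_i : i\in I\}$ of open subgroups such that every open subgroup contains some $K_i$. The language $\mathcal{L}_{\mathrm{prof}}$ is two-sorted, with a group sort carrying the group language, an index sort with a binary relation $\leq$, and a binary relation $K$ between the sorts; a profinite group with fundamental system $\{K_i:i\in I\}$ is the $\mathcal{L}_{\mathrm{prof}}$-structure $(G,I)$ with $i\le j$ iff $K_i\supseteq K_j$ and $K(G,i)=K_i$. Such a structure is dp-minimal if its theory is NIP and the partial type $x=x$ ($x$ a single variable of the group sort) has dp-rank $1$, i.e. for any two mutually indiscernible sequences and any singleton $b$ of the group sort, one of the sequences is indiscernible over $b$. *)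

(* Defs.v *)
From HB Require Import structures.
From mathcomp Require Import all_boot all_order all_algebra all_fingroup all_solvable.
From mathcomp Require Import all_classical all_reals all_analysis.

Set Implicit Arguments.
Unset Strict Implicit.
Unset Printing Implicit Defensive.

Import Order.TTheory GRing.Theory.

Local Open Scope classical_set_scope.
Local Open Scope ring_scope.

(* V and W are the types of free variables of group sort and of index sort;   *)
(* a quantifier binds the variable None.                                      *)

Inductive gterm (V : Type) : Type :=
| GVar of V
| GOne
| GInv of gterm V
| GMul of gterm V & gterm V.

Inductive formula (V W : Type) : Type :=
| FFalse
| FEqG of gterm V & gterm V
| FEqI of W & W
| FLe of W & W
| FK of gterm V & W
| FImp of formula V W & formula V W
| FAllG of formula (option V) W
| FAllI of formula V (option W).

Arguments GOne {V}.
Arguments FFalse {V W}.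

Record prof_struct := ProfStruct {
  gsort : Type;
  isort : Type;
  gone : gsort;
  ginv : gsort -> gsort;
  gmul : gsort -> gsort -> gsort;
  ile : isort -> isort -> Prop;
  irel : gsort -> isort -> Prop
}.

Definition scons (V T : Type) (x : T) (e : V -> T) (v : option V) : T :=
  if v is Some w then e w else x.

Fixpoint geval (M : prof_struct) (V : Type) (e : V -> gsort M) (t : gterm V) :
    gsort M :=
  match t with
  | GVar v => e v
  | GOne => gone M
  | GInv t1 => ginv (geval e t1)
  | GMul t1 t2 => gmul (geval e t1) (geval e t2)
  end.

Fixpoint sat (M : prof_struct) (V W : Type) (phi : formula V W) :
    (V -> gsort M) -> (W -> isort M) -> Prop :=
  match phi with
  | FFalse => fun _ _ => False
  | FEqG t1 t2 => fun e _ => geval e t1 = geval e t2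
  | FEqI i j => fun _ h => h i = h j
  | FLe i j => fun _ h => ile (h i) (h j)
  | FK t i => fun e h => irel (geval e t) (h i)
  | FImp phi1 phi2 => fun e h => sat phi1 e h -> sat phi2 e h
  | FAllG phi1 => fun e h => forall x, sat phi1 (scons x e) h
  | FAllI phi1 => fun e h => forall i, sat phi1 e (scons i h)
  end.

Definition sentence := formula void void.

Definition holds (M : prof_struct) (phi : sentence) : Prop :=
  sat phi (of_void (gsort M)) (of_void (isort M)).

Definition theory_of (M : prof_struct) : set sentence := holds M.

Definition models (M : prof_struct) (T : set sentence) : Prop := T `<=` holds M.

Definition tuple2 (M : prof_struct) (X Y : Type) : Type :=
  ((X -> gsort M) * (Y -> isort M))%type.

Definition cat2 (A B T : Type) (f : A -> T) (g : B -> T) (u : A + B) : T :=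
  match u with inl a => f a | inr b => g b end.

Definition shattered (M : prof_struct) (X Y X' Y' : Type)
    (phi : formula (X + X') (Y + Y')) (a : nat -> tuple2 M X Y) : Prop :=
  forall S : set nat, exists b : tuple2 M X' Y', forall n,
    sat phi (cat2 (a n).1 b.1) (cat2 (a n).2 b.2) <-> S n.

Definition NIP (T : set sentence) : Prop :=
  forall (X Y X' Y' : Type) (phi : formula (X + X') (Y + Y')) (M : prof_struct),
    models M T -> forall a : nat -> tuple2 M X Y, ~ shattered phi a.

(* The variable (k, v) stands for coordinate v of the tuple a_{s k}.          *)
Definition subtuple (T : Type) (n : nat) (L X : Type) (a : L -> X -> T)
    (s : 'I_n -> L) (u : 'I_n * X) : T := a (s u.1) u.2.

Definition indiscernible_over (M : prof_struct) (d : Order.disp_t)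
    (L : orderType d) (X Y : Type) (a : L -> tuple2 M X Y)
    (X' Y' : Type) (b : tuple2 M X' Y') : Prop :=
  forall (n : nat) (phi : formula ('I_n * X + X') ('I_n * Y + Y'))
      (s t : 'I_n -> L),
    {homo s : i j / (i < j)%N >-> (i < j)%O} ->
    {homo t : i j / (i < j)%N >-> (i < j)%O} ->
    let sat_at r := sat phi
      (cat2 (subtuple (fun l => (a l).1) r) b.1)
      (cat2 (subtuple (fun l => (a l).2) r) b.2) in
    sat_at s <-> sat_at t.

Definition elements_of (M : prof_struct) (L X Y : Type)
    (a : L -> tuple2 M X Y) : tuple2 M (L * X) (L * Y) :=
  (fun u => (a u.1).1 u.2, fun u => (a u.1).2 u.2).

Definition mutually_indiscernible (M : prof_struct) (d d' : Order.disp_t)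
    (L : orderType d) (L' : orderType d') (X Y X' Y' : Type)
    (a : L -> tuple2 M X Y) (a' : L' -> tuple2 M X' Y') : Prop :=
  indiscernible_over a (elements_of a') /\
  indiscernible_over a' (elements_of a).

Definition gsingleton (M : prof_struct) (b : gsort M) : tuple2 M unit void :=
  (fun=> b, of_void (isort M)).

(* Quantifying over all models of T replaces working in a monster model; the  *)
(* sequences range over all infinite linear order types and all tuple lengths. *)
Definition group_sort_dp_rank1 (T : set sentence) : Prop :=
  forall M : prof_struct, models M T ->
  forall (d d' : Order.disp_t) (L : orderType d) (L' : orderType d'),
    infinite_set [set: L] -> infinite_set [set: L'] ->
  forall (X Y X' Y' : Type)
      (a : L -> tuple2 M X Y) (a' : L' -> tuple2 M X' Y'),
    mutually_indiscernible a a' ->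
  forall b : gsort M,
    indiscernible_over a (gsingleton b) \/ indiscernible_over a' (gsingleton b).

Definition dp_minimal (M : prof_struct) : Prop :=
  NIP (theory_of M) /\ group_sort_dp_rank1 (theory_of M).

Definition profinite (A : topologicalZmodType) : Prop :=
  [/\ compact [set: A], hausdorff_space A & totally_disconnected [set: A]].

Definition fundamental_system (A : topologicalZmodType) (I : Type)
    (K : I -> zmodClosed A) : Prop :=
  (forall i, open [set` K i]) /\
  (forall U : zmodClosed A, open [set` U] ->
     exists i, [set` K i] `<=` [set` U]).

Definition prof_struct_of (A : zmodType) (I : Type) (K : I -> zmodClosed A) :
    prof_struct :=
  {| gsort := A; isort := I; gone := 0; ginv := -%R; gmul := +%R;
     ile := fun i j => [set` K j] `<=` [set` K i];
     irel := fun x i => x \in K i |}.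

Definition top_isom (B C : topologicalZmodType) : Prop :=
  exists (f : {additive B -> C}) (g : C -> B),
    [/\ cancel f g, cancel g f, continuous f & continuous g].

Section Discrete.
Variable T : zmodType.

HB.instance Definition _ := GRing.Zmodule.copy (discrete_topology T) T.

Fact discrete_sub_continuous :
  continuous (fun x : discrete_topology T * discrete_topology T => x.1 - x.2).
Proof.
move=> [x y] S /nbhs_singleton Sxy; exists ([set x], [set y]) => /=.
  by split; exact: discrete_set1.
by move=> [u v] [/= -> ->].
Qed.

HB.instance Definition _ :=
  PreTopologicalNmodule_isTopologicalZmodule.Build (discrete_topology T)
    discrete_sub_continuous.
End Discrete.

Fact continuousB_zmod (S : topologicalType) (M : topologicalZmodType)
    (f g : S -> M) :
  continuous f -> continuous g -> continuous (fun x => f x - g x).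
Proof.
move=> cf cg x.
apply: (@continuous2_cvg _ _ _ _ _ _ f g (fun a b : M => a - b)).
- exact: (@tvs.sub_continuous M (f x, g x)).
- exact: cf.
- exact: cg.
Qed.

(* Alias of B * C: the library makes B * C a topologicalZmodType only when B  *)
(* and C are topological vector spaces.                                       *)
Definition pair_group (B C : Type) : Type := (B * C)%type.

Section Pair.
Variables B C : topologicalZmodType.
Local Notation D := (pair_group B C).

HB.instance Definition _ := Topological.copy D (B * C)%type.
HB.instance Definition _ := GRing.Zmodule.copy D (B * C)%type.

Fact pair_sub_continuous :
  continuous (fun x : D * D => x.1 - x.2).
Proof.
have c1 : continuous (fun y : D * D => y.1.1 - y.2.1).
  apply: continuousB_zmod => y; apply: continuous_comp;
    by [exact: cvg_fst | exact: cvg_snd].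
have c2 : continuous (fun y : D * D => y.1.2 - y.2.2).
  apply: continuousB_zmod => y; apply: continuous_comp;
    by [exact: cvg_fst | exact: cvg_snd].
by move=> x; exact: cvg_pair (c1 x) (c2 x).
Qed.

HB.instance Definition _ :=
  PreTopologicalNmodule_isTopologicalZmodule.Build D pair_sub_continuous.
End Pair.

Section Product.
Variables (I : Type) (T : I -> topologicalZmodType).
Local Notation P := (prod_topology T).

Definition prod_zero : P := fun i => 0.
Definition prod_opp (f : P) : P := fun i => - f i.
Definition prod_add (f g : P) : P := fun i => f i + g i.

Fact prod_addA : associative prod_add.
Proof. by move=> f g h; apply: functional_extensionality_dep => i; exact: addrA. Qed.

Fact prod_addC : commutative prod_add.
Proof. by move=> f g; apply: functional_extensionality_dep => i; exact: addrC. Qed.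

Fact prod_add0 : left_id prod_zero prod_add.
Proof. by move=> f; apply: functional_extensionality_dep => i; exact: add0r. Qed.

Fact prod_addN : left_inverse prod_zero prod_opp prod_add.
Proof. by move=> f; apply: functional_extensionality_dep => i; exact: addNr. Qed.

HB.instance Definition _ :=
  GRing.isZmodule.Build P prod_addA prod_addC prod_add0 prod_addN.

Fact prod_sub_continuous : continuous (fun x : P * P => x.1 - x.2).
Proof.
have pc i : continuous (fun f : P => f i).
  move=> f; have /cvg_sup/(_ i) h : f --> f by exact: cvg_id.
  move=> V; rewrite nbhsE => -[W [oW Wf] WV].
  apply: h; rewrite nbhsE; exists ((fun f : P => f i) @^-1` W).
    by split => //; exists W.
  by move=> z /= /WV.
move=> x; apply/cvg_sup => i.
pose w (f : P) := f i.
have : continuous (fun z : P * P => z.1 - z.2 : initial_topology w).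
  apply: (@continuous_comp_initial _ _ _ w).
  apply: (@continuousB_zmod _ (T i) (fun z : P * P => z.1 i) (fun z => z.2 i)).
  - by move=> z; apply: (@continuous_comp _ _ _ fst (fun f : P => f i));
      [exact: cvg_fst | exact: pc].
  - by move=> z; apply: (@continuous_comp _ _ _ snd (fun f : P => f i));
      [exact: cvg_snd | exact: pc].
by move=> /(_ x).
Qed.

HB.instance Definition _ :=
  PreTopologicalNmodule_isTopologicalZmodule.Build P prod_sub_continuous.
End Product.

Section Subgroup.
Variables (A : topologicalZmodType) (U : zmodClosed A).

Definition subgroup_type : Type := {x : A | x \in U}.

HB.instance Definition _ := SubChoice.on subgroup_type.
HB.instance Definition _ := [SubChoice_isSubZmodule of subgroup_type by <:].
HB.instance Definition _ := Topological.copy subgroup_type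
  (initial_topology (val : subgroup_type -> A)).

Fact subgroup_sub_continuous :
  continuous (fun x : subgroup_type * subgroup_type => x.1 - x.2).
Proof.
apply: (@continuous_comp_initial _ _ _ (val : subgroup_type -> A)) => x.
have vc : continuous (val : subgroup_type -> A) by exact: initial_continuous.
rewrite [_ \o _](_ : _ = fun x => val x.1 - val x.2); last first.
  by apply/funext => y; exact: raddfB.
apply: continuousB_zmod => y.
- by apply: continuous_comp; [exact: cvg_fst | exact: vc].
- by apply: continuous_comp; [exact: cvg_snd | exact: vc].
Qed.

HB.instance Definition _ :=
  PreTopologicalNmodule_isTopologicalZmodule.Build subgroup_type
    subgroup_sub_continuous.
End Subgroup.

Definition primes_type : Type := {p : nat | prime p}.

(* Z_p is the inverse limit of the Z/p^(n+1); the index is shifted because    *)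
(* 'Z_1 is not the trivial ring.                                              *)
Section Padic.
Variable p : primes_type.

Definition Zpow_prod : Type :=
  prod_topology (fun n : nat => discrete_topology 'Z_(val p ^ n.+1)).

HB.instance Definition _ := TopologicalZmodule.on Zpow_prod.

Definition coherent : {pred Zpow_prod} :=
  fun f => `[< forall n, f n = (nat_of_ord (f n.+1))%:R :> 'Z_(val p ^ n.+1) >].

Fact Zp_natrD (m n : nat) (x y : 'I_m.+2) : (n.+2 %| m.+2)%N ->
  (nat_of_ord (x + y))%:R =
    (nat_of_ord x)%:R + (nat_of_ord y)%:R :> 'I_n.+2.
Proof.
by move=> nm; rewrite -natrD !Zp_nat; apply/val_inj; rewrite /= modn_dvdm.
Qed.

Fact coherent_zmod_closed : zmod_closed coherent.
Proof.
have p1 : (1 < val p)%N by exact/prime_gt1/(valP p).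
have q1 n : (1 < val p ^ n.+1)%N by rewrite -(exp1n n.+1) ltn_exp2r.
have dv n :
    ((Zp_trunc (val p ^ n.+1)).+2 %| (Zp_trunc (val p ^ n.+2)).+2)%N.
  by rewrite !Zp_cast // dvdn_exp2l.
split; first by apply/asboolP => n.
move=> f g /asboolP cf /asboolP cg; apply/asboolP => n.
rewrite -[LHS]/(f n - g n); apply/eqP; rewrite subr_eq eq_sym; apply/eqP.
rewrite (cf n) (cg n).
rewrite -[X in nat_of_ord X](_ : f n.+1 - g n.+1 = _) //.
by rewrite -(Zp_natrD _ _ (dv n)) subrK.
Qed.

HB.instance Definition _ := GRing.isZmodClosed.Build Zpow_prod coherent
  coherent_zmod_closed.

Definition padic_int : Type := subgroup_type coherent.
HB.instance Definition _ := TopologicalZmodule.on padic_int.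
End Padic.

(* Main.v *)
(* In a group of dp-rank 1, two families of definable subgroups are uniformly *)
(* commensurable: for X and Y in the families, one of X / (X :&: Y) and       *)
(* Y / (X :&: Y) has bounded order, since otherwise the cosets of X and of Y  *)
(* form an inp-pattern of depth two. The mutually indiscernible sequences     *)
(* extracted from such a pattern live in an ultrapower: one averages over all *)
(* pairs of sequences of indices with respect to the limit of the powers of   *)
(* an ultrafilter on nat.                                                     *)
(* Applied to pA and the K_i, this shows that pA is finite or of finite       *)
(* index. If pA is finite and A / pA is infinite, then p K_i = 0 for some i;  *)
(* commensurability of the K_i makes A metrizable, and a chain of open        *)
(* subgroups with successive indices p identifies K_i with F_p ^ nat.         *)
(* If pA has finite index for all p, then A / p ^ n A is finite. Smith's      *)
(* normal form gives a basis of it, an ultralimit over n of lifts of these    *)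
(* bases works for all n, and its coordinates are p-adic integers (infinite   *)
(* order) or lie in a finite p-group; the primes are glued by the Chinese     *)
(* remainder theorem and compactness.                                         *)

Require Import Defs.
From HB Require Import structures.
From mathcomp Require Import all_boot all_order all_algebra all_fingroup all_solvable.
From mathcomp Require Import all_classical all_reals all_analysis.

Set Implicit Arguments.
Unset Strict Implicit.
Unset Printing Implicit Defensive.

Import Order.TTheory GRing.Theory.

Local Open Scope classical_set_scope.
Local Open Scope ring_scope.

(** * Ultraproducts *)

(** Dp-rank 1 forbids inp-patterns of depth two. If subgroups [X] and [Y] both had many cosets in
    each other, the sums [a k + b l] would realize every pair of cosets. By compactness the
    forbidden size is uniform in a definable family ([dp_rank1_inp_bound]), which bounds one of two
    indices for any [K i] and [K j], and for [pA] against any [K i] ([dp_fundamental_bound],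
    [dp_multiples_bound]). The mutually indiscernible sequences of the definition come from an
    arbitrary pattern through an ultrapower in which indices are drawn by iterated limits
    ([dp_rank1_no_inp_pattern]), in place of a Ramsey argument.

    For a prime [p], therefore, [pA] has finite index or some [K i] is killed by [p]
    ([multiples_dichotomy]). If [pA] has infinite index for one [p], this [K i] is an infinite
    vector space over F_p. Countably many [K j] intersect trivially ([countable_fundamental]), and a
    chain of hyperplanes that descends below all of them gives every element a unique sequence of
    digits in F_p ([elementary_abelian_isom]).

    If all [pA] have finite index, the [p ^ n A] are open, and the finite groups [A / p ^ n A] have
    bases from which an ultralimit extracts one tuple that works for all [n] ([adapted_limit]). Its
    members of unbounded order give coordinates in Z_p, the others a finite p-group
    ([padic_decomposition]). The coordinates at all primes are jointly injective, since an element
    divisible by every positive integer lies in every open subgroup, and have dense image by the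
    Chinese remainder theorem ([product_decomposition]). In both cases compactness turns an
    injective continuous homomorphism with dense image into an isomorphism ([compact_dense_iso]). *)

Record ultra (J : Type) (F : set (set J)) : Prop := Ultra {
  ultraS : forall P Q : set J, P `<=` Q -> F P -> F Q;
  ultraI : forall P Q : set J, F P -> F Q -> F (P `&` Q);
  ultraC : forall P : set J, F (~` P) <-> ~ F P }.

Section UltraTheory.
Variables (J : Type) (F : set (set J)).
Hypothesis uF : ultra F.

Lemma ultra_ext (P Q : set J) : (forall j, P j <-> Q j) -> F P <-> F Q.
Proof. by move=> PQ; split; apply: (ultraS uF) => j /PQ. Qed.

Lemma ultraT (P : set J) : (forall j, P j) -> F P.
Proof.
move=> allP; apply: contrapT => nFP; apply: (nFP).
by apply: (ultraS uF) ((ultraC uF P).2 nFP) => j _; exact: allP.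
Qed.

Lemma ultra_ex (P : set J) : F P -> exists j, P j.
Proof.
move=> FP; apply: contrapT => nP; apply: ((ultraC uF P).1 _ FP).
by apply: (ultraS uF) FP => j Pj; case: nP; exists j.
Qed.

Lemma ultra_imp (P Q : set J) :
  F [set j | P j -> Q j] <-> (F P -> F Q).
Proof.
split=> [FPQ FP | FPQ].
  by apply: (ultraS uF) (ultraI uF FPQ FP) => j [] /= + Pj; exact.
apply: contrapT => /(ultraC uF) FN.
have FP : F P by apply: (ultraS uF) FN => j /= /not_implyP[].
have : F (~` Q) by apply: (ultraS uF) FN => j /= /not_implyP[].
by move/(ultraC uF); apply; exact: FPQ.
Qed.

End UltraTheory.

Lemma free_ultra_exists :
  exists U : set (set nat), ultra U /\ UltraFilter U /\
    forall n, U [set m | (n <= m)%N].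
Proof.
have [U [UU sU]] := @ultraFilterLemma nat \oo _.
exists U; split; last by split=> // n; apply: sU; exists n.
split=> [P Q PQ|P Q|P]; [exact: filterS | exact: filterI |].
split=> [UC UP|nUP].
  apply: (@filter_not_empty nat U (ultra_proper (F:=U))).
  by rewrite -(setICl P); apply: filterI.
by have [/nUP|] := in_ultra_setVsetC P UU.
Qed.

Definition omega : set (set nat) := sval (cid free_ultra_exists).

Lemma omega_ultra : ultra omega.
Proof. by rewrite /omega; case: cid => U []. Qed.

Lemma omega_ultrafilter : UltraFilter omega.
Proof. by rewrite /omega; case: cid => U [? []]. Qed.

Lemma omega_ge n : omega [set m | (n <= m)%N].
Proof. by rewrite /omega; case: cid => U [_ [_ Uge]] /=; exact: Uge. Qed.

Section Ultrapower.
Variables (J : Type) (F : set (set J)).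
Hypothesis uF : ultra F.

Definition ucls (T : Type) (f : J -> T) : set (J -> T) :=
  [set g | F [set j | f j = g j]].

(** Classes are sets of sequences, and [urepr] picks representatives, so that the operations of the
    ultrapower are defined without checking compatibility. *)
Definition upow (T : Type) : Type := {S : set (J -> T) | exists f, S = ucls f}.

Definition upi (T : Type) (f : J -> T) : upow T :=
  exist _ (ucls f) (ex_intro _ f erefl).

Definition urepr (T : Type) (x : upow T) : J -> T := sval (cid (svalP x)).

Lemma ureprK (T : Type) (x : upow T) : upi (urepr x) = x.
Proof.
rewrite /upi /urepr; case: cid => /= f xE.
by case: x xE => S SE /= xE; apply: eq_exist.
Qed.

Lemma upiP (T : Type) (f g : J -> T) :
  upi f = upi g <-> F [set j | f j = g j].
Proof.
split=> [/(congr1 sval) /= fg|fg].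
  have : ucls g g by apply: ultraT.
  by rewrite -fg.
apply: eq_exist; apply/seteqP; split=> h fh.
  by apply: (ultraS uF) (ultraI uF fg fh) => j /= [-> ->].
by apply: (ultraS uF) (ultraI uF fg fh) => j /= [-> ->].
Qed.

Lemma urepr_upi (T : Type) (f : J -> T) : F [set j | urepr (upi f) j = f j].
Proof. by apply/upiP; exact: ureprK. Qed.

Variable M : prof_struct.

Definition ultrapower : prof_struct :=
  {| Defs.gsort := upow (Defs.gsort M); isort := upow (isort M);
     gone := upi (fun=> gone M);
     ginv := fun x => upi (fun j => ginv (urepr x j));
     gmul := fun x y => upi (fun j => gmul (urepr x j) (urepr y j));
     ile := fun x y => F [set j | ile (urepr x j) (urepr y j)];
     irel := fun x y => F [set j | irel (urepr x j) (urepr y j)] |}.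

Definition upi_env (V T : Type) (e : V -> J -> T) (v : V) : upow T := upi (e v).

Lemma geval_upi (V : Type) (e : V -> J -> Defs.gsort M) (t : gterm V) :
  geval (M := ultrapower) (upi_env e) t = upi (fun j => geval (e^~ j) t).
Proof.
elim: t => //= [t -> | t -> u ->]; apply/upiP.
  by apply: (ultraS uF) (urepr_upi (fun j => geval (e^~ j) t)) => j /= ->.
apply: (ultraS uF) (ultraI uF (urepr_upi (fun j => geval (e^~ j) t))
  (urepr_upi (fun j => geval (e^~ j) u))).
by move=> j /= [-> ->].
Qed.

Lemma scons_upi (V T : Type) (x : J -> T) (e : V -> J -> T) :
  scons (upi x) (upi_env e) = upi_env (scons x e).
Proof. by apply/funext => -[]. Qed.

Lemma scons_at (V T : Type) (x : J -> T) (e : V -> J -> T) j :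
  (scons x e)^~ j = scons (x j) (e^~ j).
Proof. by apply/funext => -[]. Qed.

Lemma upow_forall (T : Type) (P : J -> T -> Prop) :
  (forall x : J -> T, F [set j | P j (x j)]) <-> F [set j | forall x, P j x].
Proof.
split=> [FP|FP x]; last by apply: (ultraS uF) FP => j /= /(_ (x j)).
apply: contrapT => /(ultraC uF) FN.
(* A counterexample is chosen at every [j] that has one; [x0] is only the default value
   elsewhere. *)
have [j0 /= /existsNP[x0 _]] := ultra_ex uF FN.
have /choice[x xP] j : exists y, (~ forall x, P j x) -> ~ P j y.
  have [allP|/existsNP[y nPy]] := pselect (forall x, P j x); last by exists y.
  by exists x0.
have : F (~` [set j | P j (x j)]) by apply: (ultraS uF) FN => j /= /xP.
by move/(ultraC uF); apply; exact: FP.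
Qed.

(** The theorem of Los. Every element of the ultrapower is the class of its representative
    ([ureprK]), which reduces the quantifier cases to [upow_forall]. *)
Lemma los (V W : Type) (phi : formula V W) (e : V -> J -> Defs.gsort M)
    (h : W -> J -> isort M) :
  sat (M := ultrapower) phi (upi_env e) (upi_env h) <->
  F [set j | sat phi (e^~ j) (h^~ j)].
Proof.
elim: phi e h => {V W} /= [V W|V W t u|V W i k|V W i k|V W t i|
  V W f IHf g IHg|V W f IH|V W f IH] e h.
- by split=> // /(ultra_ex uF)[].
- by rewrite !geval_upi; exact: upiP.
- exact: upiP.
- rewrite /upi_env; split=> H; apply: (ultraS uF)
    (ultraI uF H (ultraI uF (urepr_upi (h i)) (urepr_upi (h k)))) => j /=.
    by move=> [? [<- <-]].
  by move=> [? [-> ->]].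
- rewrite geval_upi /upi_env; split=> H; apply: (ultraS uF) (ultraI uF H
    (ultraI uF (urepr_upi (fun j => geval (e^~ j) t)) (urepr_upi (h i)))) => j /=.
    by move=> [? [<- <-]].
  by move=> [? [-> ->]].
- by rewrite IHf IHg; apply: iff_sym; exact: ultra_imp.
- apply: iff_trans (upow_forall (fun j x => sat f (scons x (e^~ j)) (h^~ j))).
  split=> H x.
    have := H (upi x); rewrite scons_upi => /IH; apply: (ultraS uF) => j /=.
    by rewrite scons_at.
  rewrite -(ureprK x) scons_upi; apply/IH; apply: (ultraS uF) (H (urepr x)) => j /=.
  by rewrite scons_at.
- apply: iff_trans (upow_forall (fun j x => sat f (e^~ j) (scons x (h^~ j)))).
  split=> H x.
    have := H (upi x); rewrite scons_upi => /IH; apply: (ultraS uF) => j /=.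
    by rewrite scons_at.
  rewrite -(ureprK x) scons_upi; apply/IH; apply: (ultraS uF) (H (urepr x)) => j /=.
  by rewrite scons_at.
Qed.

Lemma ultrapower_models (T : set sentence) : models M T -> models ultrapower T.
Proof.
move=> MT phi /MT Mphi; rewrite /holds.
have -> : of_void (Defs.gsort ultrapower) = upi_env (fun (v : void) _ => of_void _ v).
  by apply/funext => -[].
have -> : of_void (isort ultrapower) = upi_env (fun (v : void) _ => of_void _ v).
  by apply/funext => -[].
by apply/los; apply: ultraT => // j.
Qed.

End Ultrapower.

(** * Iterated limits *)

(** The m-fold Fubini power of [omega], seen on sequences of length [m]; the first entry is drawn
    first. *)
Fixpoint iterlim (m : nat) (P : set (seq nat)) : Prop :=
  if m is k.+1 then omega [set x | iterlim k (fun l => P (x :: l))]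
  else P [::].

Lemma iterlim_mono m (P Q : set (seq nat)) :
  (forall l, size l = m -> P l -> Q l) -> iterlim m P -> iterlim m Q.
Proof.
elim: m P Q => [|m IH] P Q PQ /=; first exact: PQ.
apply: (ultraS omega_ultra) => x; apply: IH => l sl; apply: PQ.
by rewrite /= sl.
Qed.

Lemma iterlimI m (P Q : set (seq nat)) :
  iterlim m P -> iterlim m Q -> iterlim m (P `&` Q).
Proof.
elim: m P Q => [|m IH] P Q //= FP FQ.
apply: (ultraS omega_ultra) (ultraI omega_ultra FP FQ) => x [].
exact: IH.
Qed.

Lemma iterlimC m (P : set (seq nat)) : iterlim m (~` P) <-> ~ iterlim m P.
Proof.
elim: m P => [|m IH] P //=; apply: iff_trans (ultraC omega_ultra _).
by apply: (ultra_ext omega_ultra) => x; exact: IH.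
Qed.

Lemma iterlim_mask (b : bitseq) (Q : set (seq nat)) :
  iterlim (size b) (fun l => Q (mask b l)) <-> iterlim (count id b) Q.
Proof.
elim: b Q => [|[] b IH] Q //=.
  by apply: (ultra_ext omega_ultra) => x; exact: IH.
rewrite add0n -IH; split=> [/(ultra_ex omega_ultra)[] //|h].
exact: (ultraT omega_ultra).
Qed.

(* The limit along omega of the iterated products of omega. An iterated limit *)
(* does not see dummy variables, so whether seqlim-almost all x satisfy a     *)
(* property of (x k_1, ..., x k_n) does not depend on k_1 < ... < k_n.        *)
Definition seqlim (P : set (nat -> nat)) : Prop :=
  omega [set m | iterlim m (fun l => P (nth 0%N l))].

Lemma seqlim_ultra : ultra seqlim.
Proof.
split=> [P Q PQ|P Q FP FQ|P].
- by apply: (ultraS omega_ultra) => m /=; apply: iterlim_mono => l _ /PQ.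
- apply: (ultraS omega_ultra) (ultraI omega_ultra FP FQ) => m [].
  exact: iterlimI.
- apply: iff_trans (ultraC omega_ultra _).
  by apply: (ultra_ext omega_ultra) => m; exact: iterlimC.
Qed.

Lemma seqlim_iterlim (n : nat) (s : 'I_n -> nat) (Q : set (seq nat)) :
  {homo s : i j / (i < j)%N >-> (i < j)%O} ->
  seqlim (fun x => Q [seq x k | k <- codom s]) <-> iterlim n Q.
Proof.
move=> s_homo.
have [M sM] : exists M, forall i, (s i < M)%N.
  exists (\max_i s i).+1 => i; rewrite ltnS.
  exact: leq_bigmax.
have key m : (M <= m)%N ->
    iterlim m (fun l => Q [seq nth 0%N l k | k <- codom s]) <-> iterlim n Q.
  (* [b] marks the range of [s] among the positions below [m]. As [s] increases, the marked
     positions in order are [codom s], so reading a sequence at [codom s] is masking it by [b]. *)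
  move=> Mm; pose b := [seq k \in codom s | k <- iota 0 m].
  have cE : [seq k <- iota 0 m | k \in codom s] = codom s.
    apply: (irr_sorted_eq ltn_trans ltnn).
    - exact: (sorted_filter ltn_trans _ (iota_ltn_sorted 0 m)).
    - rewrite /codom /image_mem sorted_map.
      apply: (@sub_sorted _ (relpre val ltn)) => [i j /s_homo //|].
      by rewrite enumT -sorted_map -enumT val_enum_ord iota_ltn_sorted.
    - move=> k; rewrite mem_filter mem_iota add0n /=.
      case kP : (k \in codom s) => //=.
      by case/codomP: kP => i ->; rewrite (leq_trans (sM i) Mm).
  have sb : size b = m by rewrite size_map size_iota.
  have nb : count id b = n.
    by rewrite count_map -size_filter cE size_codom card_ord.
  rewrite -{2}nb -iterlim_mask sb.
  have mE l : size l = m -> [seq nth 0%N l k | k <- codom s] = mask b l.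
    move=> sl; rewrite -{1}cE filter_mask map_mask.
    by rewrite (_ : map _ _ = l) // -sl; exact: (mkseq_nth 0%N l).
  by split; apply: iterlim_mono => l /mE ->.
rewrite /seqlim; split=> [|nQ].
  move=> /(ultraI omega_ultra (omega_ge M))/(ultra_ex omega_ultra)[m [Mm]].
  exact: (key m Mm).1.
by apply: (ultraS omega_ultra) (omega_ge M) => m Mm; exact: (key m Mm).2.
Qed.

(** Both sides are the same n-fold iterated limit. All indiscernibility below comes from here. *)
Lemma seqlim_indisc (n : nat) (s t : 'I_n -> nat) (Q : ('I_n -> nat) -> Prop) :
  {homo s : i j / (i < j)%N >-> (i < j)%O} ->
  {homo t : i j / (i < j)%N >-> (i < j)%O} ->
  seqlim (fun x => Q (x \o s)) <-> seqlim (fun x => Q (x \o t)).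
Proof.
pose Q' l := Q (fun i : 'I_n => nth 0%N l i).
have QE (r : 'I_n -> nat) (x : nat -> nat) :
    Q' [seq x k | k <- codom r] <-> Q (x \o r).
  rewrite /Q'; suff -> : (fun i : 'I_n => nth 0%N [seq x k | k <- codom r] i) =
    x \o r by [].
  apply/funext => i /=; rewrite (nth_map 0%N) ?size_codom ?card_ord //.
  by rewrite (nth_map i) ?size_enum_ord // nth_ord_enum.
move=> hs ht; have := seqlim_iterlim Q' hs; have := seqlim_iterlim Q' ht.
move=> <-; rewrite !(ultra_ext seqlim_ultra (QE s)).
by rewrite !(ultra_ext seqlim_ultra (QE t)).
Qed.

(** The factors index the two rows of a pattern; the outer limit draws the indices of the first
    row. *)
Definition seqlim2 (P : set ((nat -> nat) * (nat -> nat))) : Prop :=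
  seqlim [set x | seqlim [set y | P (x, y)]].

Lemma seqlim2_ultra : ultra seqlim2.
Proof.
have uV := seqlim_ultra; split=> [P Q PQ|P Q FP FQ|P].
- by apply: (ultraS uV) => x /=; apply: (ultraS uV) => y; exact: PQ.
- by apply: (ultraS uV) (ultraI uV FP FQ) => x [] /=; exact: (ultraI uV).
- apply: iff_trans (ultraC uV _).
  by apply: (ultra_ext uV) => x; exact: (ultraC uV).
Qed.

(** [omega] contains all final segments, so an index drawn later almost always exceeds an earlier
    one. *)
Lemma seqlim_neq k l : k <> l -> seqlim [set x | x k != x l].
Proof.
wlog kl : k l / (k < l)%N => [H kNl|_].
  have [/H|/H h|//] := ltngtP k l; first exact.
  apply: (ultraS seqlim_ultra) (h (nesym kNl)) => x /=; by rewrite eq_sym.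
pose s (i : 'I_2) := if i == ord0 then k else l.
have hs : {homo s : i j / (i < j)%N >-> (i < j)%O}.
  by case=> [[|[|?]] ?] [[|[|?]] ?]; rewrite /s //= ltEnat.
have := (@seqlim_iterlim 2 s (fun l => nth 0 l 0 != nth 0 l 1)%N hs).2 _.
move/(_ _)/(ultraS seqlim_ultra); apply.
  move=> x /=; rewrite /codom /image_mem enumT -enumT.
  by rewrite (_ : enum 'I_2 = [:: ord0; ord_max]) //; apply: (inj_map val_inj);
     rewrite val_enum_ord.
move=> /=; apply: (ultraT omega_ultra) => x.
by apply: (ultraS omega_ultra) (omega_ge x.+1) => y /= /ltn_eqF ->.
Qed.

(** * Inp-patterns of depth two *)

Section InpPatterns.
Variables (X Y X' Y' : Type).
Variable phi : formula ('I_1 * X + unit) ('I_1 * Y + void).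
Variable phi' : formula ('I_1 * X' + unit) ('I_1 * Y' + void).

(** The variables have the shape that [indiscernible_over] takes for [n = 1] and a single
    parameter. *)
Definition sat1 (M : prof_struct) (U W : Type)
    (psi : formula ('I_1 * U + unit) ('I_1 * W + void))
    (x : Defs.gsort M) (c : tuple2 M U W) : Prop :=
  sat psi (cat2 (fun u => c.1 u.2) (fun=> x))
    (cat2 (fun u => c.2 u.2) (of_void (isort M))).

(** An inp-pattern of depth two with 2-inconsistent rows; [D] will be a finite initial segment or
    [setT]. *)
Definition inp_pattern (M : prof_struct) (D : set nat)
    (a : nat -> tuple2 M X Y) (a' : nat -> tuple2 M X' Y') : Prop :=
  [/\ forall k l x, D k -> D l -> k <> l ->
        sat1 phi x (a k) -> ~ sat1 phi x (a l),
      forall k l x, D k -> D l -> k <> l ->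
        sat1 phi' x (a' k) -> ~ sat1 phi' x (a' l) &
      forall k l, D k -> D l ->
        exists x, sat1 phi x (a k) /\ sat1 phi' x (a' l)].

Definition uptuple (J : Type) (F : set (set J)) (M : prof_struct) (U W : Type)
    (c : J -> tuple2 M U W) : tuple2 (ultrapower F M) U W :=
  (upi_env F (fun v j => (c j).1 v), upi_env F (fun v j => (c j).2 v)).

Lemma sat_eq (M : prof_struct) (V W : Type) (psi : formula V W)
    (e e' : V -> Defs.gsort M) (h h' : W -> isort M) :
  e =1 e' -> h =1 h' -> sat psi e h <-> sat psi e' h'.
Proof. by move=> /funext -> /funext ->. Qed.

Lemma los1 (J : Type) (F : set (set J)) (uF : ultra F) (M : prof_struct)
    (U W : Type) (psi : formula ('I_1 * U + unit) ('I_1 * W + void))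
    (x : J -> Defs.gsort M) (c : J -> tuple2 M U W) :
  sat1 (M := ultrapower F M) psi (upi F x) (uptuple F c) <->
  F [set j | sat1 psi (x j) (c j)].
Proof.
rewrite /sat1 [X in sat psi X](_ : _ =
  upi_env F (cat2 (fun u j => (c j).1 u.2) (fun=> x))); last first.
  by apply/funext => -[].
rewrite [X in sat psi _ X](_ : _ =
  upi_env F (cat2 (fun u j => (c j).2 u.2) (fun v _ => of_void _ v))); last first.
  by apply/funext => -[//|[]].
rewrite los //; apply: (ultra_ext uF) => j.
by apply: sat_eq => -[//|[]].
Qed.

(** Compactness: patterns of every finite length are put together in an ultrapower along [omega], as
    any two given columns exist for almost all [n]. *)
Lemma inp_pattern_finitary (M : prof_struct) :
  (forall n, exists a a', inp_pattern (M := M) [set k | (k < n)%N] a a') ->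
  exists a a', inp_pattern (M := ultrapower omega M) setT a a'.
Proof.
move=> /choice[a /choice[a' pat]].
have uO := omega_ultra.
exists (fun k => uptuple omega (fun n => a n k)).
exists (fun k => uptuple omega (fun n => a' n k)); split.
- move=> k l x _ _ kl; rewrite -(ureprK x).
  move=> /(los1 uO) hk /(los1 uO) hl.
  have [n [[/= sk sl] /= klt]] := ultra_ex uO (ultraI uO (ultraI uO hk hl)
    (ultraI uO (omega_ge k.+1) (omega_ge l.+1))).
  by case: klt => kn ln; case: (pat n) => + _ _; move=> /(_ k l _ kn ln kl sk).
- move=> k l x _ _ kl; rewrite -(ureprK x).
  move=> /(los1 uO) hk /(los1 uO) hl.
  have [n [[/= sk sl] /= klt]] := ultra_ex uO (ultraI uO (ultraI uO hk hl)
    (ultraI uO (omega_ge k.+1) (omega_ge l.+1))).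
  by case: klt => kn ln; case: (pat n) => _ + _; move=> /(_ k l _ kn ln kl sk).
- move=> k l _ _.
  have /choice[x xP] n : exists x, (k < n)%N -> (l < n)%N ->
      sat1 phi x (a n k) /\ sat1 phi' x (a' n l).
    have [/andP[kn ln]|nkl] := pselect ((k < n)%N && (l < n)%N).
      by case: (pat n) => _ _ /(_ k l kn ln)[x xP]; exists x.
    by exists (gone M) => kn ln; case: nkl; rewrite kn.
  exists (upi omega x); split; apply/(los1 uO); apply: (ultraS uO)
    (ultraI uO (omega_ge k.+1) (omega_ge l.+1)) => n [/= kn ln];
  by have [] := xP n kn ln.
Qed.

(** In the ultrapower along [seqlim2], [b k] is the entry of the row [a] at the index drawn in
    position [k]. The limit does not depend on the positions, so [b] and [b'] are mutually
    indiscernible; let [x] realize their formulas at position 0. If, say, [b] is indiscernible over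
    [x], then [x] also satisfies [phi] with [b 1]. But the indices in positions 0 and 1 differ
    almost always, against the inconsistency of the row. *)
Lemma dp_rank1_no_inp_pattern (T : set sentence) (M : prof_struct) :
  group_sort_dp_rank1 T -> models M T ->
  forall a a', ~ inp_pattern (M := M) setT a a'.
Proof.
move=> dpT MT a a' [pa pa' pex].
pose F := seqlim2; have uF : ultra F := seqlim2_ultra.
pose N := ultrapower F M.
pose b k : tuple2 N X Y := uptuple F (fun j => a (j.1 k)).
pose b' k : tuple2 N X' Y' := uptuple F (fun j => a' (j.2 k)).
have /choice[x xP] (j : (nat -> nat) * (nat -> nat)) : exists y,
    sat1 phi y (a (j.1 0%N)) /\ sat1 phi' y (a' (j.2 0%N)).
  exact: pex.
have indb : mutually_indiscernible b b'.
  split=> n psi s t hs ht /=.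
    pose Q (y : nat -> nat) (r : 'I_n -> nat) := sat psi
      (cat2 (subtuple (fun l => (a l).1) r) (fun u => (a' (y u.1)).1 u.2))
      (cat2 (subtuple (fun l => (a l).2) r) (fun u => (a' (y u.1)).2 u.2)).
    have losQ r : sat psi
        (cat2 (subtuple (fun l => (b l).1) r) (elements_of b').1)
        (cat2 (subtuple (fun l => (b l).2) r) (elements_of b').2) <->
        F [set j : (nat -> nat) * (nat -> nat) | Q j.2 (j.1 \o r)].
      rewrite [X in sat psi X](_ : _ = upi_env F (cat2
        (fun u j => (a (j.1 (r u.1))).1 u.2)
        (fun u j => (a' (j.2 u.1)).1 u.2))); last by apply/funext => -[].
      rewrite [X in sat psi _ X](_ : _ = upi_env F (cat2
        (fun u j => (a (j.1 (r u.1))).2 u.2)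
        (fun u j => (a' (j.2 u.1)).2 u.2))); last by apply/funext => -[].
      by rewrite los //; apply: (ultra_ext uF) => j; apply: sat_eq => -[].
    rewrite !losQ.
    (* The outer limit draws the indices of this row, so the inner one is absorbed into the
       predicate; for the other row the outer value is fixed instead. *)
    exact: (@seqlim_indisc n s t (fun r => seqlim [set y | Q y r]) hs ht).
  pose Q (y : nat -> nat) (r : 'I_n -> nat) := sat psi
    (cat2 (subtuple (fun l => (a' l).1) r) (fun u => (a (y u.1)).1 u.2))
    (cat2 (subtuple (fun l => (a' l).2) r) (fun u => (a (y u.1)).2 u.2)).
  have losQ r : sat psi
      (cat2 (subtuple (fun l => (b' l).1) r) (elements_of b).1)
      (cat2 (subtuple (fun l => (b' l).2) r) (elements_of b).2) <->
      F [set j : (nat -> nat) * (nat -> nat) | Q j.1 (j.2 \o r)].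
    rewrite [X in sat psi X](_ : _ = upi_env F (cat2
      (fun u j => (a' (j.2 (r u.1))).1 u.2)
      (fun u j => (a (j.1 u.1)).1 u.2))); last by apply/funext => -[].
    rewrite [X in sat psi _ X](_ : _ = upi_env F (cat2
      (fun u j => (a' (j.2 (r u.1))).2 u.2)
      (fun u j => (a (j.1 u.1)).2 u.2))); last by apply/funext => -[].
    by rewrite los //; apply: (ultra_ext uF) => j; apply: sat_eq => -[].
  rewrite !losQ; apply: (ultra_ext seqlim_ultra) => y.
  exact: (@seqlim_indisc n s t (Q y) hs ht).
pose c k : 'I_1 -> nat := fun=> k.
have c_homo k : {homo c k : i j / (i < j)%N >-> (i < j)%O}.
  by move=> i j; rewrite !ord1.
have neq1 : F [set j : (nat -> nat) * (nat -> nat) | j.1 0%N != j.1 1%N].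
  apply: (ultraS seqlim_ultra) (@seqlim_neq 0 1 _) => // y yn /=.
  exact: (ultraT seqlim_ultra).
have neq2 : F [set j : (nat -> nat) * (nat -> nat) | j.2 0%N != j.2 1%N].
  by apply: (ultraT seqlim_ultra) => y /=; exact: seqlim_neq.
have xb0 : sat1 (M := N) phi (upi F x) (b 0%N).
  by apply/(los1 uF); apply: (ultraT uF) => j; case: (xP j).
have xb'0 : sat1 (M := N) phi' (upi F x) (b' 0%N).
  by apply/(los1 uF); apply: (ultraT uF) => j; case: (xP j).
have [ib|ib'] := dpT N (ultrapower_models uF MT) _ _ _ _ infinite_nat infinite_nat
  _ _ _ _ b b' indb (upi F x).
  have /= := ib 1%N phi (c 0%N) (c 1%N) (c_homo 0%N) (c_homo 1%N).
  case=> /(_ xb0) xb1 _.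
  have /(los1 uF) xb1' : sat1 (M := N) phi (upi F x) (b 1%N) by exact: xb1.
  have [j [[/= nj s1] s0]] := ultra_ex uF (ultraI uF (ultraI uF neq1 xb1')
    ((los1 uF _ _ _).1 xb0)).
  exact: (pa _ _ _ I I (elimN eqP nj) s0 s1).
have /= := ib' 1%N phi' (c 0%N) (c 1%N) (c_homo 0%N) (c_homo 1%N).
case=> /(_ xb'0) xb1 _.
have /(los1 uF) xb1' : sat1 (M := N) phi' (upi F x) (b' 1%N) by exact: xb1.
have [j [[/= nj s1] s0]] := ultra_ex uF (ultraI uF (ultraI uF neq2 xb1')
  ((los1 uF _ _ _).1 xb'0)).
exact: (pa' _ _ _ I I (elimN eqP nj) s0 s1).
Qed.

Lemma dp_rank1_inp_bound (M : prof_struct) :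
  group_sort_dp_rank1 (theory_of M) ->
  exists n, forall a a', ~ inp_pattern (M := M) [set k | (k < n)%N] a a'.
Proof.
move=> dpM; apply: contrapT => nb.
have [n|a [a' pat]] := @inp_pattern_finitary M.
  by apply: contrapT => na; apply: nb; exists n => a a' pat; apply: na; exists a, a'.
apply: (dp_rank1_no_inp_pattern dpM) pat.
by apply: ultrapower_models => //; exact: omega_ultra.
Qed.

End InpPatterns.

(** * Compact groups *)

Section ClopenSeparation.
Variable T : topologicalType.
Hypotheses (cT : compact [set: T]) (hT : hausdorff_space T).
Hypothesis tdT : totally_disconnected [set: T].

Definition quasi_component (x : T) : set T :=
  [set y | forall D, clopen D -> D x -> D y].

(** Clopen sets around [x] are closed under intersection and shrink to the quasi-component, so by
    compactness one of them is inside [W]. The filter [F] says that a property holds for all small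
    enough clopen neighbourhoods of [x]. *)
Lemma quasi_component_clopen_nbhs (x : T) (W : set T) :
  open W -> quasi_component x `<=` W ->
  exists D, [/\ clopen D, D x & D `<=` W].
Proof.
move=> oW QW; pose F : set_system (set T) := [set S | exists D0,
  [/\ clopen D0, D0 x & forall D, clopen D -> D x -> D `<=` D0 -> S D]].
have FF : Filter F.
  split.
  - by exists setT; split=> //; split; [exact: openT | exact: closedT].
  - move=> P Q [D1 [cD1 xD1 PD1]] [D2 [cD2 xD2 QD2]].
    exists (D1 `&` D2); split=> //; first exact: clopenI.
    move=> D cD xD D12; split; [apply: PD1 | apply: QD2] => // z /D12[] //.
  - move=> P Q PQ [D1 [cD1 xD1 PD1]]; exists D1; split=> // D cD xD DD.
    exact/PQ/PD1.
have /compact_near_coveringP/(_ _ F (fun D z => D z -> W z) FF) := cT.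
case=> [z _|D0 [cD0 xD0 /(_ D0 cD0 xD0)]]; last first.
  by move=> D0W; exists D0; split=> // z D0z; exact: D0W.
have [Wz|nWz] := pselect (W z).
  exists (W, setT) => /=; last by move=> [y D] /= [].
  by split; [exact: open_nbhs_nbhs | exact: filterT].
have /existsNP[D0 /not_implyP[cD0 /not_implyP[xD0 nzD0]]] : ~ quasi_component x z.
  by move/QW.
exists (~` D0, [set D | D `<=` D0]) => /=.
  split; last by exists D0; split.
  by apply: open_nbhs_nbhs; split=> //; apply: closed_openC; case: cD0.
by move=> [y D] /= [nD0y DD0] /DD0.
Qed.

(** If it split into two closed pieces, normality would enclose them in disjoint open [U] and [V].
    Some clopen [D] around [x] lies in the union of these; with [U] around the piece of [x], [D] cut
    with [U] is [D] minus [V], hence clopen, so the other piece is empty. *)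
Lemma quasi_component_connected (x : T) : connected (quasi_component x).
Proof.
have clQ : closed (quasi_component x).
  rewrite (_ : quasi_component x =
    \bigcap_(D in [set D | clopen D /\ D x]) D); last first.
    apply/seteqP; split=> [y Qy D [cD xD]|y yD D cD xD]; first exact: Qy.
    by apply: yD.
  by apply: closed_bigI => D [[]].
have xQ : quasi_component x x by [].
have half (B B' : set T) : closed B -> closed B' -> B `&` B' = set0 ->
    quasi_component x = B `|` B' -> B x -> B' = set0.
  move=> cB cB' BB' QE Bx.
  have BC' : set_nbhs B (~` B').
    apply/set_nbhsP; exists (~` B'); split=> //; first exact: closed_openC.
    exact/disjoints_subset.
  have [N /set_nbhsP[U [oU BU UN]] NB'] := compact_normal hT cT cB BC'.
  pose V := ~` closure N.
  have oV : open V by apply: closed_openC; exact: closed_closure.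
  have BV : B' `<=` V by move=> z B'z /NB'.
  have UV : U `&` V = set0.
    by apply/seteqP; split=> // z [/UN/subset_closure].
  have [|D [cD xD DUV]] := @quasi_component_clopen_nbhs x (U `|` V) (openU oU oV).
    by rewrite QE; apply: setUSS.
  have DUE : D `&` U = D `&` ~` V.
    apply/seteqP; split=> y [Dy Uy]; split=> //.
      by move=> Vy; have : (U `&` V) y by []; rewrite UV.
    by case: (DUV y Dy).
  have cDU : clopen (D `&` U).
    case: cD => oD cD; split; first exact: openI.
    by rewrite DUE; apply: closedI => //; exact: open_closedC.
  apply/seteqP; split=> // y B'y.
  have Qy : quasi_component x y by rewrite QE; right.
  have [_ Uy] : (D `&` U) y by apply: Qy => //; split=> //; exact: BU.
  by rewrite -[set0 y]/(set0 y) -UV; split=> //; exact: BV.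
move=> B [b Bb] [G oG BG] [C cC BC].
have cB : closed B by rewrite BC; exact: closedI.
have cB' : closed (quasi_component x `&` ~` G).
  by apply: closedI => //; exact: open_closedC.
have QE : quasi_component x = B `|` (quasi_component x `&` ~` G).
  by rewrite BG -setIUr setUv setIT.
have BB' : B `&` (quasi_component x `&` ~` G) = set0.
  by rewrite BG setIACA setICr setI0.
have [Bx|nBx] := pselect (B x).
  by rewrite QE (half _ _ cB cB' BB' QE Bx) setU0.
have B'x : (quasi_component x `&` ~` G) x by move: xQ; rewrite {1}QE => -[].
move: Bb; rewrite (half _ _ cB' cB _ _ B'x) //; first by rewrite setIC.
by rewrite setUC.
Qed.

Lemma clopen_nbhs_separated (x y : T) :
  x <> y -> exists D, [/\ clopen D, D x & ~ D y].
Proof.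
move=> xy; apply: contrapT => nD.
have Qy : quasi_component x y.
  by move=> D cD xD; apply: contrapT => nDy; apply: nD; exists D.
have : connected_component setT x y.
  by exists (quasi_component x) => //; split=> //; exact: quasi_component_connected.
by rewrite tdT // => /esym.
Qed.

End ClopenSeparation.

(** * Subgroups as sets *)

Definition subgrp (A : zmodType) (S : set A) : Prop :=
  S 0 /\ forall x y, S x -> S y -> S (x - y).

Section SubgrpTheory.
Variables (A : zmodType) (S : set A).
Hypothesis gS : subgrp S.

Lemma subgrp0 : S 0. Proof. by case: gS. Qed.

Lemma subgrpB x y : S x -> S y -> S (x - y).
Proof. by case: gS => _; exact. Qed.

Lemma subgrpN x : S x -> S (- x).
Proof. by move=> Sx; rewrite -sub0r; apply: subgrpB => //; exact: subgrp0. Qed.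

Lemma subgrpD x y : S x -> S y -> S (x + y).
Proof. by move=> Sx Sy; rewrite -(opprK y); apply/subgrpB/subgrpN. Qed.

Lemma subgrpMn x n : S x -> S (x *+ n).
Proof.
move=> Sx; elim: n => [|n IH]; first by rewrite mulr0n; exact: subgrp0.
by rewrite mulrS; exact: subgrpD.
Qed.

Lemma subgrpMz x z : S x -> S (x *~ z).
Proof.
by case: z => n Sx; [exact: subgrpMn | exact/subgrpN/subgrpMn].
Qed.

Lemma subgrp_sum (I : Type) (r : seq I) (P : pred I) (f : I -> A) :
  (forall i, P i -> S (f i)) -> S (\sum_(i <- r | P i) f i).
Proof.
move=> Sf; elim/big_ind : _ => //; [exact: subgrp0 | exact: subgrpD].
Qed.

Definition subgrp_pred : {pred A} := fun x => `[< S x >].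

Fact subgrp_zmod_closed : zmod_closed subgrp_pred.
Proof.
split; first exact/asboolP/subgrp0.
by move=> x y /asboolP Sx /asboolP Sy; exact/asboolP/subgrpB.
Qed.

Lemma subgrp_zmodClosed : exists U : zmodClosed A, [set` U] = S.
Proof.
pose UM := GRing.isZmodClosed.Build A subgrp_pred subgrp_zmod_closed.
pose U : zmodClosed A := HB.pack subgrp_pred UM.
by exists U; apply/seteqP; split=> x /asboolP.
Qed.

End SubgrpTheory.

Lemma subgrpI (A : zmodType) (S S' : set A) :
  subgrp S -> subgrp S' -> subgrp (S `&` S').
Proof.
move=> gS gS'; split=> [|y z [Sy S'y] [Sz S'z]]; first by split; exact: subgrp0.
by split; exact: subgrpB.
Qed.

Lemma zmodClosed_subgrp (A : zmodType) (U : zmodClosed A) : subgrp [set` U].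
Proof. by split=> [|x y] /=; [exact: rpred0 | exact: rpredB]. Qed.

(** * Index of subgroups *)

Lemma greedy_sequence (T : choiceType) (R : T -> T -> Prop) :
  (forall s : seq T, exists x, forall y, y \in s -> R y x) ->
  exists f : nat -> T, forall m n, (m < n)%N -> R (f m) (f n).
Proof.
move=> /choice[g gP].
pose l := fix l n := if n is k.+1 then g (l k) :: l k else [::].
exists (fun n => g (l n)) => m n mn; apply: gP.
elim: n mn => // n IH; rewrite ltnS leq_eqVlt in_cons => /orP[/eqP ->|/IH ->].
  by rewrite eqxx.
by rewrite orbT.
Qed.

Section Index.
Variable A : zmodType.
Implicit Types X Y S : set A.

Definition fin_index S : Prop :=
  exists s : seq A, forall x, exists2 y, y \in s & S (x - y).

(* For subgroups X and Y: X / (X `&` Y) has at least n elements.              *)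
Definition big_index (n : nat) X Y : Prop := exists a : nat -> A,
  (forall k, (k < n)%N -> X (a k)) /\
  (forall k l, (k < n)%N -> (l < n)%N -> k <> l -> ~ Y (a k - a l)).

Lemma big_index_spread n X Y (f : nat -> A) : subgrp Y ->
  (forall k, X (f k)) -> (forall k l, (k < l)%N -> ~ Y (f l - f k)) ->
  big_index n X Y.
Proof.
move=> gY Xf Yf; exists f; split=> // k l _ _ kl.
have [kl'|lk|//] := ltngtP k l; last exact: Yf.
by move=> /(subgrpN gY); rewrite opprB; exact: Yf.
Qed.

(** Greedy choice: as long as finitely many elements of [X] do not represent it modulo [Y], another
    one can be added. *)
Lemma reps_or_spread X Y :
  (exists s : seq A, (forall y, y \in s -> X y) /\
     forall x, X x -> exists2 y, y \in s & Y (x - y)) \/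
  (exists f : nat -> A, (forall k, X (f k)) /\
     forall k l, (k < l)%N -> ~ Y (f l - f k)).
Proof.
have [|nr] := pselect (exists s : seq A, (forall y, y \in s -> X y) /\
     forall x, X x -> exists2 y, y \in s & Y (x - y)); [by left|right].
have [s|f fP] := @greedy_sequence A (fun y x => X x /\ (X y -> ~ Y (x - y))).
  apply: contrapT => nx; apply: nr; exists [seq y <- s | `[< X y >]].
  split=> [y|x Xx]; first by rewrite mem_filter => /andP[/asboolP].
  apply: contrapT => ny; apply: nx; exists x => y ys; split=> // Xy Yxy.
  by apply: ny; exists y => //; rewrite mem_filter ys andbT; exact/asboolP.
(* The relation constrains only terms that have a predecessor, hence the shift. *)
exists (fun k => f k.+1); split=> [k|k l kl]; first by case: (fP 0%N k.+1).
by case: (fP k.+1 l.+1) => // _; apply; case: (fP 0%N k.+1).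
Qed.

Lemma not_big_index n X Y : subgrp Y -> ~ big_index n X Y ->
  exists s : seq A, (forall y, y \in s -> X y) /\
     forall x, X x -> exists2 y, y \in s & Y (x - y).
Proof.
move=> gY nb; have [//|[f [Xf Yf]]] := reps_or_spread X Y.
by case: nb; exact: big_index_spread Yf.
Qed.

End Index.

(** * Compact abelian groups *)

Section CompactGroup.
Variable A : topologicalZmodType.
Hypothesis cA : compact [set: A].

Lemma omega_lim (x : nat -> A) :
  exists a : A, forall V, nbhs a V -> omega [set n | V (x n)].
Proof.
have UO := omega_ultrafilter.
have FP : ProperFilter (fmap x omega).
  by apply: fmap_proper_filter; exact: ultra_proper.
have [|a [_ ax]] := cA FP; first exact: filterT.
exists a => V aV; apply: contrapT => /(ultraC omega_ultra) nV.
by have [z [nVz Vz]] := ax (~` V) V nV aV.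
Qed.

Lemma subr_cst_continuous (c : A) : continuous (fun y : A => y - c).
Proof.
by apply: continuousB_zmod; [move=> y; exact: cvg_id | exact: cst_continuous].
Qed.

Lemma translate_open (S : set A) c : open S -> open [set y | S (y - c)].
Proof.
move=> oS; apply: (@open_comp _ _ (fun y : A => y - c)) => // y _.
exact: subr_cst_continuous.
Qed.

Lemma translate_closed (S : set A) c : closed S -> closed [set y | S (y - c)].
Proof.
move=> cS; apply: (@preimage_closed _ _ (fun y : A => y - c)) => // y _.
exact: subr_cst_continuous.
Qed.

Lemma translate_nbhs (S : set A) c : nbhs (0 : A) S -> nbhs c [set y | S (y - c)].
Proof. by move=> S0; apply: subr_cst_continuous; rewrite subrr. Qed.

Lemma nbhs0_subgrp_open (S : set A) : subgrp S -> nbhs (0 : A) S -> open S.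
Proof.
move=> gS S0; rewrite openE => x Sx; rewrite /interior.
apply: filterS (translate_nbhs x S0) => y /= Syx.
by rewrite -(subrK x y); exact: subgrpD.
Qed.

Lemma open_subgrp_closed (S : set A) : subgrp S -> open S -> closed S.
Proof.
move=> gS oS; rewrite -[S]setCK; apply: open_closedC.
rewrite openE => x nSx; rewrite /interior.
have S0 : nbhs (0 : A) S by apply: open_nbhs_nbhs; split=> //; exact: subgrp0.
apply: filterS (translate_nbhs x S0) => y /= Syx Sy; apply: nSx.
by rewrite -(subKr y x); exact: subgrpB.
Qed.

(** A pigeonhole principle: almost all terms of a sequence lie in one coset of [S]. *)
Lemma omega_coset (S : set A) (x : nat -> A) : subgrp S -> open S ->
  exists a, omega [set n | S (x n - a)].
Proof.
move=> gS oS; have [a aP] := omega_lim x; exists a.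
apply: (aP [set y | S (y - a)]); apply: translate_nbhs.
by apply: open_nbhs_nbhs; split=> //; exact: subgrp0.
Qed.

Lemma open_no_spread (S : set A) (f : nat -> A) : subgrp S -> open S ->
  exists k l, (k < l)%N /\ S (f l - f k).
Proof.
move=> gS oS; have [a aP] := omega_coset f gS oS.
have [k /= Sk] := ultra_ex omega_ultra aP.
have [l [/= Sl kl]] := ultra_ex omega_ultra (ultraI omega_ultra aP (omega_ge k.+1)).
by exists k, l; split=> //; rewrite -(subrKA a) -(opprB (f k)); exact: subgrpB.
Qed.

Lemma open_subgrp_reps (X S : set A) : subgrp S -> open S ->
  exists s : seq A, (forall y, y \in s -> X y) /\
     forall x, X x -> exists2 y, y \in s & S (x - y).
Proof.
move=> gS oS; have [//|[f [_ Sf]]] := reps_or_spread X S.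
by have [k [l [/Sf]]] := open_no_spread f gS oS.
Qed.

Lemma open_subgrp_fin_index (S : set A) : subgrp S -> open S -> fin_index S.
Proof.
by move=> gS /(open_subgrp_reps setT gS)[s [_ sP]]; exists s => x; exact: sP.
Qed.

(** This is the stabilizer of [C] under translation, a subgroup. By compactness of [C] and of its
    complement, translations by elements near 0 map each of the two into itself. *)
Lemma clopen_stabilizer_open (C : set A) : clopen C ->
  open [set x | forall c, C (x + c) <-> C c].
Proof.
move=> [oC cC]; pose S := [set x : A | forall c, C (x + c) <-> C c].
have gS : subgrp S.
  split=> [c|x y Sx Sy c]; first by rewrite add0r.
  by rewrite -addrA (Sx (- y + c)) -(Sy (- y + c)) addNKr.
apply: nbhs0_subgrp_open => //.
have near_id (D : set A) : clopen D ->
    nbhs (0 : A) [set x | forall c, D c -> D (x + c)].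
  move=> [oD cD]; have cptD := subclosed_compact cD cA (@subsetT _ D).
  have /compact_near_coveringP/(_ A (nbhs (0 : A)) (fun x c => D (x + c)) _) := cptD.
  apply=> c Dc.
  have := @add_continuous A (c, 0) D; rewrite /= addr0 => nV.
  have [] : nbhs ((c, 0) : A * A) [set z | D (z.1 + z.2)].
    apply: nV; exact: open_nbhs_nbhs.
  move=> [V W] /= [cV W0] VW; exists (V, W) => //= -[c' x] [/= Vc' Wx].
  by rewrite addrC; exact: (VW (c', x)).
have h1 := near_id C (conj oC cC).
have h2 := near_id (~` C) (conj (closed_openC cC) (open_closedC oC)).
apply: filterS2 h1 h2 => x /= xC xNC c; split; last exact: xC.
by move=> Cxc; apply: contrapT => /xNC.
Qed.

Hypotheses (hA : hausdorff_space A) (tdA : totally_disconnected [set: A]).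

(** The stabilizer of a clopen set that contains 0 but not [x] does not contain [x]. *)
Lemma open_subgrp_separates (x : A) : x <> 0 ->
  exists S : set A, [/\ subgrp S, open S & ~ S x].
Proof.
move=> /nesym /(clopen_nbhs_separated cA hA tdA)[C [cC C0 nCx]].
exists [set x | forall c, C (x + c) <-> C c]; split.
- split=> [c|y z Sy Sz c]; first by rewrite add0r.
  by rewrite -addrA (Sy (- z + c)) -(Sz (- z + c)) addNKr.
- exact: clopen_stabilizer_open.
- by move=> /(_ 0); rewrite addr0 => xC; apply/nCx/xC.
Qed.

End CompactGroup.

(** * Dp-minimality and commensurability *)

Definition multiples (A : zmodType) (p : nat) : set A :=
  [set x | exists y, x = y *+ p].

Lemma multiples_subgrp (A : zmodType) (p : nat) : subgrp (multiples (A := A) p).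
Proof.
split=> [|_ _ [y ->] [z ->]]; first by exists 0; rewrite mul0rn.
by exists (y - z); rewrite mulrnBl.
Qed.

Section DpBounds.
Variables (A : topologicalZmodType) (I : Type) (K : I -> zmodClosed A).
Let M := prof_struct_of K.
Hypothesis dpK : group_sort_dp_rank1 (theory_of M).

Let in_coset : formula ('I_1 * unit + unit) ('I_1 * unit + void) :=
  FK (GMul (GVar (inr tt)) (GInv (GVar (inl (ord0, tt))))) (inl (ord0, tt)).

(** An existential quantifier written as not for all not; [None] is the bound [y] with
    [x - a = p y]. *)
Let in_multiples_coset (p : nat) :
    formula ('I_1 * unit + unit) ('I_1 * void + void) :=
  FImp (FAllG (FImp
    (FEqG _ (GMul (GVar (Some (inr tt))) (GInv (GVar (Some (inl (ord0, tt))))))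
       (iter p (GMul (GVar None)) GOne))
    FFalse)) FFalse.

Lemma sat_in_coset (x a : A) (i : I) :
  sat1 (M := M) in_coset x (fun=> a, fun=> i) <-> x - a \in K i.
Proof. by []. Qed.

Lemma sat_in_multiples_coset p (x a : A) :
  sat1 (M := M) (in_multiples_coset p) x (fun=> a, of_void I) <->
  multiples p (x - a).
Proof.
have gevalE (V : Type) (e : V -> A) (v : V) k :
    geval (M := M) e (iter k (GMul (GVar v)) GOne) = e v *+ k.
  by elim: k => [|k IH] //=; rewrite IH mulrS.
rewrite /sat1 /=; split=> [h|[y xy] h].
  apply: contrapT => nh; apply: h => y xy; apply: nh; exists y.
  by move: xy; rewrite gevalE.
by apply: (h y); rewrite gevalE.
Qed.

(** Otherwise take [b] in [K i] distinct modulo [K j], and [a] in [K j] distinct modulo [K i]. The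
    cosets [a k + K i] and [b l + K j] form an inp-pattern, as [a k + b l] lies in both. *)
Lemma dp_fundamental_bound : exists n, forall i j,
  ~ big_index n [set` K i] [set` K j] \/ ~ big_index n [set` K j] [set` K i].
Proof.
have [n np] := dp_rank1_inp_bound in_coset in_coset dpK; exists n => i j.
apply/not_andP => -[[b [Kb nKb]] [a [Ka nKa]]].
apply: (np (fun k => (fun=> a k, fun=> i)) (fun k => (fun=> b k, fun=> j))).
split=> [k l x kn ln kl|k l x kn ln kl|k l kn ln].
- move=> /sat_in_coset xk /sat_in_coset xl; apply: (nKa k l kn ln kl).
  by rewrite /= -(subrKA x) -opprB addrC rpredB.
- move=> /sat_in_coset xk /sat_in_coset xl; apply: (nKb k l kn ln kl).
  by rewrite /= -(subrKA x) -opprB addrC rpredB.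
- exists (a k + b l : A); split; apply/sat_in_coset.
    by rewrite addrC addKr; exact: Kb.
  by rewrite addrK; exact: Ka.
Qed.

Lemma dp_multiples_bound p : exists n, forall i,
  ~ big_index n (multiples p) [set` K i] \/ ~ big_index n [set` K i] (multiples p).
Proof.
have [n np] := dp_rank1_inp_bound in_coset (in_multiples_coset p) dpK.
exists n => i; apply/not_andP => -[[a [Ka nKa]] [b [Kb nKb]]].
apply: (np (fun k => (fun=> a k, fun=> i)) (fun k => (fun=> b k, of_void I))).
split=> [k l x kn ln kl|k l x kn ln kl|k l kn ln].
- move=> /sat_in_coset xk /sat_in_coset xl; apply: (nKa k l kn ln kl).
  by rewrite /= -(subrKA x) -opprB addrC rpredB.
- move=> /sat_in_multiples_coset xk /sat_in_multiples_coset xl.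
  apply: (nKb k l kn ln kl); rewrite /= -(subrKA x) -opprB addrC.
  by apply: subgrpB => //; exact: multiples_subgrp.
- exists (a k + b l : A); split.
    by apply/sat_in_coset; rewrite addrC addKr; exact: Kb.
  by apply/sat_in_multiples_coset; rewrite addrK; exact: Ka.
Qed.

End DpBounds.

(** * Fundamental systems with bounded indices *)

Lemma omega_subsequence (P : set nat) :
  omega P -> exists g : nat -> nat,
    (forall k l, (k < l)%N -> (g k < g l)%N) /\ forall k, P (g k).
Proof.
move=> oP; have [s|f fP] := @greedy_sequence nat (fun x y => (x < y)%N /\ P y).
  have [y [Py /= ym]] :=
    ultra_ex omega_ultra (ultraI omega_ultra oP (omega_ge (\max_(x <- s) x).+1)).
  exists y => x xs; split=> //; apply: leq_trans ym; rewrite ltnS.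
  by rewrite (big_rem x) //= leq_maxl.
exists (fun k => f k.+1); split=> [k l kl|k]; first by case: (fP k.+1 l.+1).
by case: (fP 0%N k.+1).
Qed.

Section Fundamental.
Variables (A : topologicalZmodType) (I : Type) (K : I -> zmodClosed A).
Hypotheses (profA : profinite A) (fundK : fundamental_system K).

Let cA : compact [set: A]. Proof. by case: profA. Qed.
Let gK i : subgrp [set` K i] := zmodClosed_subgrp (K i).
Let oK i : open [set` K i]. Proof. by case: fundK => + _; exact. Qed.

Lemma fundamental_sub (S : set A) : subgrp S -> open S ->
  exists i, [set` K i] `<=` S.
Proof.
move=> gS oS; have [U US] := subgrp_zmodClosed gS; rewrite -US.
by apply: fundK.2; rewrite US.
Qed.

Lemma fundamental_separates (s : seq A) :
  exists i, forall x, x \in s -> x \in K i -> x = 0.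
Proof.
suff [S [gS oS Ss]] : exists S : set A,
    [/\ subgrp S, open S & forall x, x \in s -> S x -> x = 0].
  have [i KS] := fundamental_sub gS oS.
  by exists i => x xs /KS; exact: Ss.
elim: s => [|x s [S [gS oS Ss]]]; first by exists setT; split=> //; exact: openT.
have [->|/eqP x0] := eqVneq x 0.
  by exists S; split=> // y; rewrite in_cons => /orP[/eqP //|]; exact: Ss.
have [_ hA tdA] := profA.
have [S' [gS' oS' nS'x]] := open_subgrp_separates cA hA tdA x0.
exists (S `&` S'); split; [exact: subgrpI|exact: openI|].
by move=> y; rewrite in_cons => /orP[/eqP -> []//|ys [Sy _]]; exact: Ss.
Qed.

(** An infinite [X] has [n] distinct elements, and some [K j] contains none of their nonzero
    differences. *)
Lemma infinite_big_index (X : set A) n :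
  ~ (exists s : seq A, forall x, X x -> x \in s) ->
  exists j, big_index n X [set` K j].
Proof.
move=> infX.
have [[s [_ sP]]|[f [Xf f0]]] := reps_or_spread X [set 0 : A].
  case: infX; exists s => x /sP[y ys /eqP]; by rewrite subr_eq0 => /eqP ->.
have [j jP] := fundamental_separates
  [seq f l - f k | k <- iota 0 n, l <- iota 0 n].
exists j, f; split=> // k l kn ln kl /= Kkl.
have h : f k - f l = 0.
  by apply: jP Kkl; apply/allpairsP; exists (l, k); rewrite !mem_iota.
have [kl'|lk|//] := ltngtP k l; last exact: (f0 _ _ lk).
by apply: (f0 _ _ kl'); rewrite /= -opprB h oppr0.
Qed.

Hypothesis infA : ~ (exists s : seq A, forall x, x \in s).

Lemma open_subgrp_infinite (S : set A) : subgrp S -> open S ->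
  ~ (exists s : seq A, forall x, S x -> x \in s).
Proof.
move=> gS oS [s sP]; apply: infA.
have [t tP] := open_subgrp_fin_index cA gS oS.
exists [seq y + z | y <- t, z <- s] => x; have [y yt Sxy] := tP x.
by apply/allpairsP; exists (y, x - y); rewrite /= subrKC; split=> //; exact: sP.
Qed.

Lemma fundamental_shrink (i : I) : exists j c,
  [/\ [set` K j] `<=` [set` K i], c \in K i & c \notin K j].
Proof.
have [c Kc c0] : exists2 c, c \in K i & c <> 0.
  apply: contrapT => nc; apply: (open_subgrp_infinite (gK i) (oK i)).
  exists [:: 0] => x Kx; rewrite inE; apply/eqP; apply: contrapT => x0.
  by apply: nc; exists x.
have [_ hA tdA] := profA.
have [S [gS oS nSc]] := open_subgrp_separates cA hA tdA c0.
have [| |j jP] := @fundamental_sub ([set` K i] `&` S).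
- exact: subgrpI.
- exact: openI.
exists j, c; split=> //; first by move=> x /jP[].
by apply/negP => /jP[_].
Qed.

(** Descend strictly in the system, with [d m] in [K (i m)] but not in [K (i m.+1)]. If the
    intersection [N] is finite, one more [K j] makes it trivial. If not, [N] is big modulo some
    [K j], hence so are all [K (i m)], and the bound makes [K j] small modulo each of them. But
    infinitely many [d m] lie in one coset of [K j], and arbitrarily many of their differences are
    distinct modulo a late [K (i m)]. *)
Lemma countable_fundamental n :
  (forall i j, ~ big_index n [set` K i] [set` K j] \/
               ~ big_index n [set` K j] [set` K i]) ->
  exists i : nat -> I, forall x, (forall m, x \in K (i m)) -> x = 0.
Proof.
move=> bnd; have [i0 _] := fundamental_separates [::].
have /choice[next /choice[c cP]] := fundamental_shrink.
pose i m := iter m next i0.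
have K_dec m l : (m <= l)%N -> [set` K (i l)] `<=` [set` K (i m)].
  move=> /subnK <-; elim: (l - m)%N => [|k IH] // x; rewrite addSn => Kx.
  by apply: IH; case: (cP (i (k + m)%N)) => + _ _; exact.
pose N : set A := [set x | forall m, x \in K (i m)].
have [[s sP]|infN] := pselect (exists s : seq A, forall x, N x -> x \in s).
  have [j jP] := fundamental_separates s.
  exists (fun m => if m is k.+1 then i k else j) => x xP.
  by apply: jP (xP 0%N); apply: sP => m; exact: (xP m.+1).
have [j [b [Nb Kb]]] := infinite_big_index n infN; exfalso.
have nbig m : ~ big_index n [set` K j] [set` K (i m)].
  case: (bnd (i m) j) => // nb _; apply: nb; exists b; split=> // k kn.
  exact: Nb.
pose d m := c (i m).
have [a /omega_subsequence[g [g_inc gP]]] := omega_coset cA d (gK j) (oK j).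
apply: (nbig (g n).+1); exists (fun k => d (g k) - d (g 0%N)); split=> [k _|].
  by rewrite -(subrKA a) -(opprB (d (g 0%N))) /=; apply: rpredB; exact: gP.
suff key k l : (k < l)%N -> (l < n)%N -> d (g l) - d (g k) \notin K (i (g n).+1).
  move=> k l kn ln kl; rewrite opprB addrA subrK /=.
  have [kl'|lk|//] := ltngtP k l.
    by rewrite -opprB rpredN; apply/negP; exact: key.
  by apply/negP; exact: key.
(* Otherwise [d (g k)] would lie in [K (i (g k).+1)], because [d (g l)] and the difference do. *)
move=> kl ln; apply/negP => /(@K_dec (g k).+1) /=.
have gkn : ((g k).+1 <= (g n).+1)%N by rewrite ltnS ltnW // g_inc // (ltn_trans kl).
move=> /(_ gkn) Kdiff; have [_ _] := cP (i (g k)); rewrite -/(d (g k)).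
rewrite -[next (i (g k))]/(i (g k).+1) => /negP; apply.
rewrite -(subKr (d (g l)) (d (g k))) rpredB //.
apply: (@K_dec _ (g l)); first exact: g_inc.
by case: (cP (i (g l))).
Qed.

End Fundamental.

(** * Homomorphisms of topological groups *)

Section TopologicalGroups.

Lemma additive_of_sub (B C : zmodType) (f : B -> C) :
  (forall x y, f (x - y) = f x - f y) -> exists g : {additive B -> C}, g =1 f.
Proof.
move=> fB; pose fM := GRing.isZmodMorphism.Build B C f fB.
by pose g : {additive B -> C} := HB.pack f fM; exists g.
Qed.

Lemma continuous_to_prod (J : Type) (S : topologicalType)
    (T : J -> topologicalType) (f : S -> prod_topology T) :
  (forall i, continuous (fun x => f x i)) -> continuous f.
Proof.
move=> fc x; apply/cvg_sup => i; pose w (h : prod_topology T) := h i.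
have : continuous (f : S -> initial_topology w).
  by apply: (@continuous_comp_initial _ _ _ w); exact: fc.
by move=> /(_ x).
Qed.

Lemma prod_proj_continuous (J : Type) (T : J -> topologicalType) i :
  continuous (fun f : prod_topology T => f i).
Proof.
move=> f; have /cvg_sup/(_ i) h : f --> f by exact: cvg_id.
move=> V; rewrite nbhsE => -[W [oW Wf] WV].
apply: h; rewrite nbhsE; exists ((fun f : prod_topology T => f i) @^-1` W).
  by split => //; exists W.
by move=> z /= /WV.
Qed.

Lemma continuous_to_discrete (B : topologicalZmodType) (D : zmodType)
    (f : B -> discrete_topology D) (S : set B) :
  (forall x y, f (x - y) = (f x : D) - f y) -> subgrp S -> open S ->
  (forall x, S x -> f x = (0 : D)) -> continuous f.
Proof.
move=> fB gS oS f0 x V /nbhs_singleton Vfx; rewrite nbhs_simpl /=.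
have S0 : nbhs (0 : B) S by apply: open_nbhs_nbhs; split=> //; exact: subgrp0.
apply: filterS (translate_nbhs x S0) => y /= /f0 /eqP.
by rewrite fB subr_eq0 => /eqP ->.
Qed.

Lemma open_forall_ltn (T : topologicalType) n (S : nat -> set T) :
  (forall k, (k < n)%N -> open (S k)) -> open [set x | forall k, (k < n)%N -> S k x].
Proof.
elim: n => [_|n IH oS].
  by rewrite (_ : mkset _ = setT); [exact: openT | exact/seteqP].
rewrite (_ : mkset _ = [set x | forall k, (k < n)%N -> S k x] `&` S n).
  by apply: openI; [apply: IH => k kn|]; apply: oS => //; exact: ltnW.
apply/seteqP; split=> [x Sx|x [Sx Sn] k]; last first.
  by rewrite ltnS leq_eqVlt => /orP[/eqP ->|/Sx].
by split=> [k kn|]; apply: Sx => //; exact: ltnW.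
Qed.

Lemma subgroup_type_compact (A : topologicalZmodType) (U : zmodClosed A) :
  compact [set: A] -> closed [set` U] -> compact [set: subgroup_type U].
Proof.
move=> cA clU F FF _; pose v : subgroup_type U -> A := val.
have cU := subclosed_compact clU cA (@subsetT _ _).
have FvP : ProperFilter (fmap v F) by exact: fmap_proper_filter.
have [|a [Ua aF]] := cU _ FvP.
  have vU y : v y \in U by exact: (valP y).
  by apply: (@filterS _ F _ setT) => [y _|]; [exact: vU | exact: filterT].
exists (exist _ a Ua : subgroup_type U); split=> // V W FV.
rewrite nbhsE => -[_ [[W' oW' <-] /= W'a] W'W].
have [_ [[u Vu <-] W'u]] : (v @` V) `&` W' !=set0.
  apply: aF; last exact: open_nbhs_nbhs.
  by apply: (@filterS _ F _ V) => // u Vu; exists u.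
by exists u; split=> //; exact: W'W.
Qed.

(** The [S n] make [C] Hausdorff, even if they are not a basis of neighbourhoods of 0. An ultralimit
    of approximate preimages of [y] is a preimage, so [f] is a continuous bijection from a compact
    space to a Hausdorff one and maps closed sets to closed sets. *)
Lemma compact_dense_iso (B C : topologicalZmodType) (f : B -> C)
    (S : nat -> set C) :
  compact [set: B] -> (forall x y, f (x - y) = f x - f y) -> continuous f ->
  (forall x, f x = 0 -> x = 0) ->
  (forall n, subgrp (S n)) -> (forall n, open (S n)) ->
  (forall m n, (m <= n)%N -> S n `<=` S m) ->
  (forall y, (forall n, S n y) -> y = 0) ->
  (forall y n, exists x, S n (f x - y)) ->
  top_isom B C.
Proof.
move=> cB fB fc finj gS oS Sle S0 fdense.
have hC : hausdorff_space C.
  rewrite open_hausdorff => y z yz.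
  have [n nS] : exists n, ~ S n (y - z).
    apply: contrapT => nS; move: yz; rewrite -subr_eq0 => /eqP; apply.
    by apply: S0 => n; apply: contrapT => ?; apply: nS; exists n.
  exists ([set x | S n (x - y)], [set x | S n (x - z)]) => /=.
    by split; rewrite inE /= subrr; exact: subgrp0.
  split; [exact: translate_open | exact: translate_open |].
  apply/eqP/seteqP; split=> // x [/= xy xz]; apply: nS.
  by rewrite -(subrKA x) -opprB addrC; apply: subgrpB.
have fsurj y : exists x, f x = y.
  have /choice[x xP] := fdense y.
  have [a aP] := omega_lim cB x; exists a; apply/eqP; rewrite -subr_eq0.
  apply/eqP; apply: S0 => n.
  have /aP : nbhs a (f @^-1` [set w | S n (w - f a)]).
    apply: fc; apply: translate_nbhs.
    by apply: open_nbhs_nbhs; split=> //; exact: subgrp0.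
  move=> /(ultraI omega_ultra (omega_ge n))/(ultra_ex omega_ultra)[m [/= nm Sm]].
  rewrite -(subrKA (f (x m))) -opprB addrC; apply: subgrpB => //.
  exact: (Sle n m).
have [g gK] := additive_of_sub fB.
have /choice[h fh] := fsurj.
have hf x : h (f x) = x.
  by apply/eqP; rewrite -subr_eq0; apply/eqP/finj; rewrite fB fh subrr.
exists g, h; split=> [x|y||].
- by rewrite gK hf.
- by rewrite gK fh.
- by rewrite (_ : GRing.Additive.sort g = f) //; apply/funext.
apply/continuous_closedP => V cV; rewrite (_ : h @^-1` V = f @` V).
  apply: compact_closed => //; apply: continuous_compact; last first.
    exact: subclosed_compact cV cB _.
  exact: continuous_subspaceT.
apply/seteqP; split=> [y Vhy|_ [x Vx <-] /=]; last by rewrite hf.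
by exists (h y) => //; rewrite fh.
Qed.

End TopologicalGroups.

(** * Open subgroups of prime exponent *)

Lemma mulrz_Zp (A : zmodType) (m : nat) (e : A) (c : int) :
  (1 < m)%N -> e *+ m = 0 -> e *~ c = e *+ nat_of_ord (c%:~R : 'Z_m).
Proof.
move=> m1; rewrite -{1}(Zp_cast m1); move: (Zp_trunc m) => {m m1} m e0.
have emod k : e *+ (k %% m.+2) = e *+ k.
  by rewrite {2}(divn_eq k m.+2) mulrnDr mulnC mulrnA e0 mul0rn add0r.
have eR k : e *+ nat_of_ord (k%:R : 'I_m.+2) = e *+ k by rewrite Zp_nat /= emod.
case: c => k; first by rewrite -pmulrn eR.
rewrite NegzE !mulrNz /= emod mulrnBr; last exact: ltnW (ltn_ord _).
by rewrite e0 sub0r -!pmulrn eR.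
Qed.

(** For a subgroup [D], the subgroup generated by [D] and [s]; the recursion exposes the coefficient
    of the head, the generator that [hyperplane] removes. *)
Fixpoint coset_span (A : zmodType) (D : set A) (s : seq A) : set A :=
  if s is w :: s' then [set x | exists c : int, coset_span D s' (x - w *~ c)]
  else D.

Section CosetSpan.
Variables (A : zmodType) (D : set A).
Hypothesis gD : subgrp D.

Lemma coset_span_subgrp s : subgrp (coset_span D s).
Proof.
elim: s => //= w s IH; split=> [|x y [c xc] [d yd]].
  by exists 0; rewrite mulr0z subr0; exact: subgrp0.
exists (c - d); rewrite mulrzBr [X in coset_span D s X](_ : _ =
  (x - w *~ c) - (y - w *~ d)); first exact: subgrpB.
by rewrite !opprD !opprK addrACA.
Qed.

Lemma coset_spanS w s : coset_span D s `<=` coset_span D (w :: s).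
Proof. by move=> x xs; exists 0; rewrite mulr0z subr0. Qed.

Lemma coset_span0 s : D `<=` coset_span D s.
Proof. by elim: s => // w s IH; apply: subset_trans IH _; exact: coset_spanS. Qed.

Lemma coset_span_mem s x : x \in s -> coset_span D s x.
Proof.
elim: s => // w s IH; rewrite in_cons => /orP[/eqP ->|/IH]; last exact: coset_spanS.
by exists 1; rewrite mulr1z subrr; exact: (subgrp0 (coset_span_subgrp s)).
Qed.

Lemma coset_span_sub W s : subgrp W -> D `<=` W -> (forall y, y \in s -> W y) ->
  coset_span D s `<=` W.
Proof.
move=> gW DW; elim: s => // w s IH sW x [c xc].
rewrite -(subrK (w *~ c) x); apply: subgrpD => //.
  by apply: IH xc => y ys; apply: sW; rewrite in_cons ys orbT.
by apply: subgrpMz => //; apply: sW; rewrite mem_head.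
Qed.

End CosetSpan.

Section ElementaryAbelian.
Variables (A : topologicalZmodType) (U : zmodClosed A) (p : nat).
Hypotheses (cA : compact [set: A]) (oU : open [set` U]) (pp : prime p).
Hypothesis pU : forall x, x \in U -> x *+ p = 0.
Hypothesis infU : ~ (exists s : seq A, forall x, x \in U -> x \in s).
Variable V : nat -> set A.
Hypotheses (gV : forall m, subgrp (V m)) (oV : forall m, open (V m)).
Hypothesis V0 : forall x, (forall m, V m x) -> x = 0.

Let gU : subgrp [set` U] := zmodClosed_subgrp U.

Let p1 : (1 < p)%N := prime_gt1 pp.

Let mulrz_Fp x (c : int) : x \in U -> x *~ c = x *+ nat_of_ord (c%:~R : 'F_p).
Proof. by move=> Ux; apply: mulrz_Zp; rewrite pdiv_id // pU. Qed.

Definition open_in_U (W : set A) : Prop :=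
  [/\ subgrp W, open W & W `<=` [set` U]].

Lemma open_in_U_large W : open_in_U W -> exists m, ~ W `<=` V m.
Proof.
move=> [gW oW WU]; apply: contrapT => nm.
have W0 x : W x -> x = 0.
  by move=> Wx; apply: V0 => m; apply: contrapT => nVx; apply: nm; exists m => /(_ x Wx).
apply: infU; have [s [_ sP]] := open_subgrp_reps cA [set` U] gW oW.
by exists s => x /sP[y ys /W0/eqP]; rewrite subr_eq0 => /eqP ->.
Qed.

(** Take a shortest sequence that generates [W] modulo [D]. Without its head [e] it generates a
    proper subgroup [H], and [W = H + Z e]. *)
Lemma hyperplane (W D : set A) : open_in_U W -> subgrp D -> open D ->
  D `<=` W -> ~ W `<=` D ->
  exists (H : set A) (e : A), [/\ open_in_U H, H `<=` W, D `<=` H, W e /\ ~ H e &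
    forall x, W x -> exists c : int, H (x - e *~ c)].
Proof.
move=> [gW oW WU] gD oD DW WD.
pose spans r := `[< exists s : seq A,
  [/\ size s = r, forall y, y \in s -> W y & W `<=` coset_span D s] >].
have ex_span : exists r, spans r.
  have [s [sW sP]] := open_subgrp_reps cA W gD oD.
  exists (size s); apply/asboolP; exists s; split=> // x /sP[y ys Dxy].
  rewrite -(subrK y x); apply: subgrpD; first exact: coset_span_subgrp.
    exact: coset_span0.
  exact: coset_span_mem.
have [r /asboolP[[|e s] [sr sW Ws]] rmin] := ex_minnP ex_span; first by case: WD.
have gH := coset_span_subgrp gD s.
have s'W y : y \in s -> W y by move=> ys; apply: sW; rewrite in_cons ys orbT.
have HW : coset_span D s `<=` W by exact: coset_span_sub.
have DH : D `<=` coset_span D s by exact: coset_span0.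
exists (coset_span D s), e; split=> //.
- split=> //; last exact: subset_trans HW WU.
  apply: nbhs0_subgrp_open => //; apply: (filterS DH).
  by apply: open_nbhs_nbhs; split=> //; exact: subgrp0.
- split; first by apply: sW; rewrite mem_head.
  move=> He; suff /rmin : spans (size s) by rewrite -sr ltnn.
  apply/asboolP; exists s; split=> // x /Ws[c xc].
  by rewrite -(subrK (e *~ c) x); apply: subgrpD => //; exact: subgrpMz.
Qed.

(** Each hyperplane is chosen to contain the intersection of [W n] with [V m], for the first [V m]
    that does not contain [W n]; this makes the chain descend below every [V m]. *)
Lemma hyperplane_chain : exists (W : nat -> set A) (e : nat -> A),
  [/\ W 0%N = [set` U], forall n, open_in_U (W n),
      forall n, W n.+1 `<=` W n /\ (W n (e n) /\ ~ W n.+1 (e n)),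
      forall n x, W n x -> exists c : int, W n.+1 (x - e n *~ c) &
      forall n m, (forall k, (k < m)%N -> W n `<=` V k) -> ~ W n `<=` V m ->
        W n `&` V m `<=` W n.+1].
Proof.
have /choice[next /choice[e eP]] (W : set A) : exists H e, open_in_U W ->
    [/\ open_in_U H, H `<=` W, W e /\ ~ H e,
      forall x, W x -> exists c : int, H (x - e *~ c) &
      forall m, (forall k, (k < m)%N -> W `<=` V k) -> ~ W `<=` V m ->
        W `&` V m `<=` H].
  have [oW|nW] := pselect (open_in_U W); last by exists W, 0.
  have exm : exists m, `[< ~ W `<=` V m >].
    by have [m mP] := open_in_U_large oW; exists m; exact/asboolP.
  have [m /asboolP Wm mmin] := ex_minnP exm.
  have [gW opW WU] := oW.
  have [||||H [e [oH HW DH eWH He]]] := @hyperplane W (W `&` V m) oW.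
  - exact: subgrpI.
  - exact: openI.
  - by move=> x [].
  - by move=> WWV; apply: Wm => x /WWV[].
  exists H, e => _; split=> // m' m'V nm'.
  suff -> : m' = m by [].
  have [mm'|m'm|//] := ltngtP m' m; last by case: Wm; exact: m'V.
  by have := mmin m' (introT (asboolP _) nm'); rewrite leqNgt mm'.
pose W n := iter n next [set` U].
have oW n : open_in_U (W n) by elim: n => [|n /eP[]//]; split.
exists W, (fun n => e (W n)); split=> // n; have [_ + + + +] := eP _ (oW n) => //.
Qed.

(** If no member of the chain were inside [V m], the open subgroup [W n] cut with [V m] would lie in
    all later members. The [e (n + j)] would then be pairwise incongruent modulo it, against
    compactness. *)
Lemma hyperplane_chain_cofinal (W : nat -> set A) (e : nat -> A) :
  (forall n, open_in_U (W n)) ->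
  (forall n, W n.+1 `<=` W n /\ (W n (e n) /\ ~ W n.+1 (e n))) ->
  (forall n m, (forall k, (k < m)%N -> W n `<=` V k) -> ~ W n `<=` V m ->
     W n `&` V m `<=` W n.+1) ->
  (forall m n, (m <= n)%N -> W n `<=` W m) ->
  forall m, exists n, forall k, (k < m)%N -> W n `<=` V k.
Proof.
move=> oW eW WV Wle; elim=> [|m [n nP]]; first by exists 0%N.
have [[l Wl]|nl] := pselect (exists l, W l `<=` V m).
  exists (maxn n l) => k; rewrite ltnS leq_eqVlt => /orP[/eqP ->|km].
    exact: subset_trans (Wle _ _ (leq_maxr n l)) Wl.
  exact: subset_trans (Wle _ _ (leq_maxl n l)) (nP k km).
have WnV j : W n `&` V m `<=` W (n + j)%N.
  elim: j => [|j IH]; first by rewrite addn0; exact: subIsetl.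
  rewrite addnS => x [Wx Vx]; apply: (WV _ m) => [k km||].
  - exact: subset_trans (Wle _ _ (leq_addr j n)) (nP k km).
  - by move=> Wnj; apply: nl; exists (n + j)%N.
  - by split=> //; exact: IH.
have [gW opW WU] := oW n.
have [k [l [kl [Wkl Vkl]]]] := open_no_spread cA (fun j => e (n + j)%N)
  (subgrpI gW (gV m)) (openI opW (oV m)).
have [_ [_ []]] := eW (n + k)%N.
rewrite -(subKr (e (n + l)%N) (e (n + k)%N)) -addnS.
have [gW' _ _] := oW (n + k.+1)%N; apply: subgrpB => //; last exact: WnV.
by apply: (Wle _ (n + l)%N); [rewrite leq_add2l | case: (eW (n + l)%N) => _ []].
Qed.

(** Every [x] in [U] has a unique sequence of digits [d] with [x - part d n] in [W n] for all [n].
    The digits are additive, the first [n] of them depend only on [x] modulo [W n], and every finite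
    sequence of digits occurs. *)
Lemma elementary_abelian_isom :
  top_isom (subgroup_type U) (prod_topology (fun _ : nat => discrete_topology 'F_p)).
Proof.
have [W [e [W0 oW eW digW WV]]] := hyperplane_chain.
have gW n : subgrp (W n) by case: (oW n).
have WU n : W n `<=` [set` U] by case: (oW n).
have Wle m n : (m <= n)%N -> W n `<=` W m.
  move=> /subnK <-; elim: (n - m)%N => [|k IH] //; rewrite addSn.
  by apply: subset_trans IH; case: (eW (k + m)%N).
have WI x : (forall n, W n x) -> x = 0.
  move=> Wx; apply: V0 => m.
  have [n nP] := hyperplane_chain_cofinal oW eW WV Wle m.+1.
  exact: (nP m (ltnSn m)).
have eU n : e n \in U by case: (eW n) => _ [/WU].
pose part (d : nat -> 'F_p) n : A := \sum_(k < n) e k *+ nat_of_ord (d k).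
pose digits x d := forall n, W n (x - part d n).
have /choice[dig digP] (nx : nat * A) : exists c : 'F_p,
    W nx.1 nx.2 -> W nx.1.+1 (nx.2 - e nx.1 *+ nat_of_ord c).
  have [/digW[c cP]|nW] := pselect (W nx.1 nx.2); last by exists 0.
  by exists c%:~R => _; rewrite -mulrz_Fp.
have digits_ex x : x \in U -> exists d, digits x d.
  (* [r n] is what remains of [x] after the removal of [n] digits. *)
  move=> Ux; pose r := fix r n := if n is k.+1
    then r k - e k *+ nat_of_ord (dig (k, r k)) else x.
  exists (fun k => dig (k, r k)) => n.
  have -> : x - part (fun k => dig (k, r k)) n = r n.
    elim: n => [|n IH]; first by rewrite /part big_ord0 subr0.
    by rewrite /part big_ord_recr /= opprD addrA IH.
  elim: n => [|n IH] /=; first by rewrite W0.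
  exact: (digP (n, r n)).
have partB d d' n : part d n - part d' n = part (fun k => d k - d' k) n.
  rewrite /part -sumrB; apply: eq_bigr => k _.
  have eD (a b : 'F_p) :
      e k *+ nat_of_ord (a + b) = e k *+ nat_of_ord a + e k *+ nat_of_ord b.
    have := mulrz_Fp (Posz (nat_of_ord a + nat_of_ord b)) (eU k).
    by rewrite -!pmulrn natrD !natr_Zp mulrnDr => ->.
  by have := eD (d k - d' k) (d' k); rewrite subrK => ->; rewrite addrK.
have digitsB x y d d' : digits x d -> digits y d' ->
    digits (x - y) (fun k => d k - d' k).
  move=> xd yd n; rewrite -partB; have := subgrpB (gW n) (xd n) (yd n).
  by rewrite !opprD !opprK addrACA.
have digits0 x d n : digits x d -> W n x -> forall k, (k < n)%N -> d k = 0.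
  move=> xd Wx; elim/ltn_ind => k IH kn.
  have part0 : part d k = 0.
    rewrite /part big1 // => i _.
    by rewrite IH ?mulr0n // (ltn_trans (ltn_ord i)).
  have := xd k.+1; rewrite /part big_ord_recr /= -/(part d k) part0 add0r.
  have Wk1x : W k.+1 x by exact: (Wle _ n).
  move=> /(subgrpB (gW k.+1) Wk1x); rewrite subKr => Wek.
  apply: contrapT => /eqP dk0; have [_ [_ []]] := eW k.
  (* A nonzero digit is invertible modulo [p], so a multiple of [e k] by it lies in [W k.+1] only if
     [e k] does. *)
  have -> : e k = (e k *+ nat_of_ord (d k)) *+ nat_of_ord (d k)^-1; last exact: subgrpMn.
  rewrite -mulrnA.
  have := mulrz_Fp (Posz (nat_of_ord (d k) * nat_of_ord (d k)^-1)) (eU k).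
  rewrite -!pmulrn => ->; rewrite natrM !natr_Zp divff //.
have /choice[f fP] (x : subgroup_type U) : exists d, digits (val x) d.
  exact: digits_ex (valP x).
have digits_uniq x d d' : digits x d -> digits x d' -> d = d'.
  move=> xd xd'; apply/funext => k; apply/eqP; rewrite -subr_eq0.
  have h := digitsB _ _ _ _ xd xd'; rewrite subrr in h.
  by apply/eqP/(digits0 _ _ k.+1 h) => //; exact: subgrp0.
pose F (x : subgroup_type U) :
  prod_topology (fun _ : nat => discrete_topology 'F_p) := f x.
have FB x y : F (x - y) = F x - F y.
  apply: (digits_uniq (val (x - y))); first exact: fP.
  by rewrite raddfB; apply: digitsB; exact: fP.
have clU := open_subgrp_closed gU oU.
have oval (S : set A) : open S -> open ((val : subgroup_type U -> A) @^-1` S).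
  by move=> oS; exists S.
pose C := prod_topology (fun _ : nat => discrete_topology 'F_p).
apply: (@compact_dense_iso _ C F
  (fun n => [set d : C | forall k, (k < n)%N -> d k = 0])).
- exact: subgroup_type_compact.
- exact: FB.
- apply: continuous_to_prod => k.
  apply: (@continuous_to_discrete _ _ _ ((val : subgroup_type U -> A) @^-1` W k.+1)).
  + by move=> x y; rewrite FB.
  + split=> [|x y Wx Wy]; first exact: (subgrp0 (gW k.+1)).
    exact: (subgrpB (gW k.+1) Wx Wy).
  + by apply: oval; case: (oW k.+1).
  + by move=> x Wx; exact: (digits0 (val x) _ k.+1).
- move=> x Fx; apply: val_inj; apply: WI => n.
  have := fP x n; rewrite (_ : part (f x) n = 0) ?subr0 //.
  by rewrite -[f x]/(F x) Fx /part big1.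
- move=> n; split=> [k kn //|x y x0 y0 k kn].
  by rewrite -[LHS]/(x k - y k) x0 // y0 // subr0.
- move=> n; apply: (@open_forall_ltn C n (fun k => [set d : C | d k = 0])) => k _.
  apply: (@open_comp _ _ (fun d : C => d k) [set 0]); last exact: discrete_open.
  by move=> d _; exact: prod_proj_continuous.
- by move=> m n mn d d0 k km; apply: d0; exact: leq_trans mn.
- by move=> d d0; apply/funext => k; exact: (d0 k.+1).
- move=> d n.
  have Upart : part d n \in U by apply: rpred_sum => k _; exact: rpredMn.
  pose x : subgroup_type U := exist _ (part d n) Upart.
  have fx : digits (part d n) (f x) := fP x.
  exists x => k kn.
  rewrite -[LHS]/(F _ k - d k).
  (* The digits of a partial sum are those of [d], truncated. *)
  have dd : digits (part d n) (fun k => if (k < n)%N then d k else 0).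
    move=> m; have [mn|nm] := leqP m n; last first.
      rewrite (_ : part _ m = part d n) ?subrr; first exact: subgrp0.
      rewrite /part -(subnKC (ltnW nm)) big_split_ord /= [X in _ + X]big1.
        by rewrite addr0; apply: eq_bigr => i _; rewrite ltn_ord.
      by move=> i _; rewrite ltnNge leq_addr.
    rewrite /part -(subnKC mn) big_split_ord /= [X in _ - X](_ : _ =
      \sum_(i < m) e i *+ nat_of_ord (d i)); last first.
      by apply: eq_bigr => i _; rewrite (leq_trans (ltn_ord i)) ?leq_addr.
    rewrite addrAC subrr add0r; apply: subgrp_sum => // i _; apply: subgrpMn => //.
    by apply: (Wle m (m + i)%N); [exact: leq_addr | case: (eW (m + i)%N) => _ []].
  by rewrite /F (digits_uniq _ _ _ fx dd) kn subrr.
Qed.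

End ElementaryAbelian.

(** * Adapted generators *)

Lemma multiples_dvd (A : zmodType) (m n : nat) : (m %| n)%N ->
  multiples (A := A) n `<=` multiples m.
Proof. by move=> /dvdnP[k ->] _ [y ->]; exists (y *+ k); rewrite -mulrnA. Qed.

Section AdaptedGenerators.
Variables (A : zmodType) (p d : nat).
Hypothesis pp : prime p.
Implicit Types (b g : 'I_d -> A) (c : 'I_d -> int) (e : 'I_d -> nat).

Definition comb b c : A := \sum_i b i *~ c i.

Let N n : set A := multiples (p ^ n).
Let gN n : subgrp (N n) := multiples_subgrp A (p ^ n).

Definition generates b n : Prop := forall x, exists c, N n (x - comb b c).

(* The images of the b i form a basis of the finite abelian group A / p ^ n A *)
(* (with trivial vectors allowed), that of b i having order p ^ e i.          *)
Definition adapted (n : nat) b e : Prop :=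
  [/\ generates b n, forall i, (e i <= n)%N, forall i, N n (b i *+ p ^ e i) &
    forall c, N n (comb b c) -> forall i, ((p ^ e i)%:Z %| c i)%Z].

Lemma combB b c c' : comb b c - comb b c' = comb b (fun i => c i - c' i).
Proof. by rewrite /comb -sumrB; apply: eq_bigr => i _; rewrite mulrzBr. Qed.

Lemma combMn b c k : comb b c *+ k = comb b (fun i => c i * k%:Z).
Proof.
by rewrite /comb -sumrMnl; apply: eq_bigr => i _; rewrite -mulrzA_C mulrzAC pmulrn.
Qed.

Lemma comb_delta b i k : comb b (fun j => (k *+ (j == i))%:Z) = b i *+ k.
Proof.
rewrite /comb (bigD1 i) //= eqxx big1 ?addr0 // => j /negPf ->.
by rewrite mulr0z.
Qed.

(** The error [p ^ n y] is improved by expanding [y] modulo [p]. *)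
Lemma generates_step g : generates g 1 -> forall n, generates g n.
Proof.
move=> g1; elim=> [|n IH] x.
  by exists (fun=> 0); exists (x - comb g (fun=> 0)); rewrite mulr1n.
have [c [y xy]] := IH x; have [c' [z yz]] := g1 y.
exists (fun i => c i - - (c' i * (p ^ n)%:Z)); exists z.
rewrite expnS -[(p * _)%N]/(p ^ 1 * p ^ n)%N mulrnA -yz mulrnBl -xy combMn.
rewrite -addrA -opprD; congr (_ - _).
rewrite /comb -big_split; apply: eq_bigr => i _ /=.
by rewrite opprK mulrzDr.
Qed.

(** The relations between the [g j] modulo [p ^ n A] form a subgroup of Z^d that contains [q Z^d].
    Smith's normal form of a matrix of generators gives a basis change [R] after which the relations
    are diagonal, with entries dividing [q], hence powers of [p] up to sign. *)
Lemma adapted_exists g n : generates g 1 -> exists b e, adapted n b e.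
Proof.
move=> /generates_step gen; pose q := (p ^ n)%N.
have q0 : (0 < q)%N by rewrite expn_gt0 prime_gt0.
pose phi (r : 'rV[int]_d) : A := comb g (fun j => r 0 j).
have phiB r s : phi (r - s) = phi r - phi s.
  by rewrite combB; apply: eq_bigr => i _; rewrite !mxE.
have phi_mul k (x : 'rV[int]_k) (Y : 'M[int]_(k, d)) :
    phi (x *m Y) = \sum_i phi (row i Y) *~ x 0 i.
  rewrite /phi /comb; under [RHS]eq_bigr do rewrite mulrz_suml.
  rewrite exchange_big /=; apply: eq_bigr => j _; rewrite mxE.
  by rewrite mulrz_sumr; apply: eq_bigr => i _; rewrite !mxE -mulrzA mulrC.
(* Generators of the relations are the finitely many ones with entries in [[0, q)] and the unit
   vectors times [q]. A tuple that is not a relation contributes a zero row. *)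
pose T := {ffun 'I_d -> 'I_q}.
pose rowT (f : T) : 'rV[int]_d := \row_j (f j : nat)%:Z.
pose rel (f : T) : 'rV[int]_d := if `[< N n (phi (rowT f)) >] then rowT f else 0.
pose relmx : 'M[int]_(#|T| + d, d) :=
  col_mx (\matrix_(k < #|T|) rel (enum_val k)) q%:Z%:M.
have qphi r : N n (phi (q%:Z *: r)).
  exists (phi r); rewrite combMn; apply: eq_bigr => i _.
  by rewrite mxE mulrC.
have relP r : N n (phi r) <-> exists x, r = x *m relmx.
  split=> [Nr|[x ->]]; last first.
    rewrite phi_mul; apply: (subgrp_sum (gN n)) => i _; apply: subgrpMz => //.
    rewrite /relmx; case: (splitP i) => k ik.
      have -> : i = lshift d k by exact: val_inj.
      rewrite rowKu rowK /rel; case: asboolP => // _.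
      by rewrite /phi /comb big1 => [|j _]; [exact: subgrp0|rewrite mxE mulr0z].
    have -> : i = rshift #|T| k by exact: val_inj.
    rewrite rowKd (_ : row k _ = q%:Z *: delta_mx 0 k); first exact: qphi.
    by rewrite -row1 -[q%:Z%:M]scalemx1 linearZ.
  have modlt (j : 'I_d) : (`|(r 0%R j %% q%:Z)%Z| < q)%N.
    by rewrite -ltz_nat gez0_abs ?modz_ge0 ?ltz_pmod // -lt0n.
  pose f : T := [ffun j => Ordinal (modlt j)].
  have rE : r = rowT f + q%:Z *: (\row_j (r 0%R j %/ q%:Z)%Z).
    apply/rowP => j; rewrite !mxE ffunE /= gez0_abs ?modz_ge0 -?lt0n //.
    by rewrite addrC mulrC -divz_eq.
  have Nf : N n (phi (rowT f)).
    have -> : rowT f = r - q%:Z *: (\row_j (r 0%R j %/ q%:Z)%Z).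
      by rewrite {1}rE addrK.
    by rewrite phiB; exact: subgrpB.
  exists (row_mx (delta_mx 0 (enum_rank f)) (\row_j (r 0%R j %/ q%:Z)%Z)).
  rewrite mul_row_col -rowE rowK enum_rankK /rel (asboolT Nf) mul_mx_scalar.
  exact: rE.
have [L uL [R uR [s _ relE]]] := int_Smith_normal_form relmx.
pose b i := phi (row i R).
have combE c : comb b c = phi ((\row_i c i) *m R).
  by rewrite phi_mul; apply: eq_bigr => i _; rewrite mxE.
have NP c : N n (comb b c) <-> forall i : 'I_d, (s`_i %| c i)%Z.
  rewrite combE relP relE; split=> [[x /(canRL (mulmxK uR))]|sc].
    rewrite mulmxA mulmxK // mulmxA => cE i.
    have := congr1 (fun r : 'rV_d => r 0 i) cE; rewrite !mxE => ->.
    apply: rpred_sum => k _.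
    rewrite !mxE; case: eqP => [->|_]; last by rewrite mulr0n mulr0 dvdz0.
    by rewrite mulr1n dvdz_mull.
  pose y : 'rV[int]_(#|T| + d) := \row_k if insub (k : nat) is Some i then
    (c i %/ s`_k)%Z else 0.
  exists (y *m invmx L); rewrite !mulmxA mulmxKV //; congr (_ *m _).
  apply/rowP => i; rewrite !mxE.
  have id : (i < #|T| + d)%N by rewrite (leq_trans (ltn_ord i)) ?leq_addl.
  rewrite (bigD1 (Ordinal id)) //= !mxE /= eqxx mulr1n big1 ?addr0.
    by rewrite (valK i : insub (nat_of_ord i) = Some i) divzK.
  move=> k ki; rewrite !mxE; case: eqP => [kiE|_]; last by rewrite mulr0n mulr0.
  by case/eqP: ki; apply: val_inj.
have sq (i : 'I_d) : (s`_i %| q%:Z)%Z.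
  have : N n (comb b (fun j => (q *+ (j == i))%:Z)).
    by rewrite comb_delta; exists (b i).
  by move=> /NP/(_ i); rewrite eqxx.
have /choice[e eP] (i : 'I_d) : exists k, (k <= n)%N /\ absz s`_i = (p ^ k)%N.
  have : (absz (nth 0%R s i) %| p ^ n)%N by exact: sq.
  by move=> /(dvdn_pfactor _ _ pp)[k kn sk]; exists k.
have dvdE i z : ((p ^ e i)%:Z %| z)%Z = (s`_i %| z)%Z.
  by rewrite -(eP i).2 !dvdzE.
exists b, e; split=> [x|i|i|c /NP cs i].
- have [c xc] := gen n x; pose r : 'rV[int]_d := \row_i c i.
  exists (fun i => (r *m invmx R) 0 i).
  have -> : comb b (fun i => (r *m invmx R) 0 i) = comb g c => //.
  rewrite combE (_ : \row_i _ = r *m invmx R); last by apply/rowP => i; rewrite mxE.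
  by rewrite mulmxKV //; apply: eq_bigr => i _; rewrite mxE.
- exact: (eP i).1.
- rewrite -comb_delta; apply/NP => j; rewrite -dvdE.
  by case: eqP => [->|_]; rewrite ?mulr1n ?dvdzz // mulr0n dvdz0.
- by rewrite dvdE.
Qed.

End AdaptedGenerators.

Section AdaptedLevels.
Variables (A : zmodType) (p d : nat).
Hypothesis pp : prime p.
Implicit Types (b : 'I_d -> A) (c : 'I_d -> int) (e : 'I_d -> nat).

Let N n : set A := multiples (p ^ n).
Let gN n : subgrp (N n) := multiples_subgrp A (p ^ n).

Lemma multiples_exp_le m n : (m <= n)%N -> N n `<=` N m.
Proof. by move=> mn; apply: multiples_dvd; rewrite dvdn_exp2l. Qed.

(** If [comb b c = p ^ n y], expand [y] as [comb b m] modulo [p ^ n.+1 A]: then [p ^ e i] divides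
    [c i - p ^ n m i], so the smaller of [p ^ n] and [p ^ e i] divides [c i]. *)
Lemma adapted_pred n b e :
  adapted p n.+1 b e -> adapted p n b (fun i => minn n (e i)).
Proof.
move=> [gen le_e ord_e rel_e]; split=> [x|i|i|c Nc i].
- by have [c xc] := gen x; exists c; apply: (multiples_exp_le (leqnSn n)).
- by rewrite geq_minl.
- rewrite /minn; case: ltnP => _; first by exists (b i).
  exact: (multiples_exp_le (leqnSn n) (ord_e i)).
have [y cy] := Nc; have [m [z yz]] := gen y.
have : N n.+1 (comb b (fun i => c i - m i * (p ^ n)%:Z)).
  rewrite -combB cy -combMn -mulrnBl yz mulrnAC.
  by exists (z *+ p ^ n).
move=> /rel_e/(_ i) h; rewrite -(subrK (m i * (p ^ n)%:Z) (c i)).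
apply: rpredD; last first.
  by apply: dvdz_mull; rewrite dvdzE /= dvdn_exp2l // geq_minl.
by apply: dvdz_trans h; rewrite dvdzE /= dvdn_exp2l // geq_minr.
Qed.

Lemma adapted_uniq n b e e' : adapted p n b e -> adapted p n b e' -> e =1 e'.
Proof.
suff le f f' : adapted p n b f -> adapted p n b f' -> forall i, (f i <= f' i)%N.
  by move=> h h' i; apply/eqP; rewrite eqn_leq !(le _ _ h h', le _ _ h' h).
move=> [_ _ _ rel_f] [_ _ ord_f' _] i.
have := ord_f' i; rewrite -comb_delta => /rel_f/(_ i).
by rewrite eqxx mulr1n dvdzE /= dvdn_Pexp2l ?prime_gt1.
Qed.

Lemma adapted_le m n b e : (m <= n)%N ->
  adapted p n b e -> adapted p m b (fun i => minn m (e i)).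
Proof.
move=> /subnK <-; elim: (n - m)%N e => [|k IH] e.
  rewrite add0n => h; suff <- : e = (fun i => minn m (e i)) by [].
  by apply/funext => i; case: h => _ /(_ i) + _ _ => /minn_idPr.
rewrite addSn => /adapted_pred/IH; congr adapted.
by apply/funext => i; rewrite minnA (minn_idPl (leq_addl k m)).
Qed.

Lemma adapted_perturb n b b' e : (forall i, N n (b' i - b i)) ->
  adapted p n b e -> adapted p n b' e.
Proof.
move=> bb' [gen le_e ord_e rel_e].
have Ncomb c : N n (comb b' c - comb b c).
  rewrite /comb -sumrB; apply: (subgrp_sum (gN n)) => i _.
  by rewrite -mulrzBl; exact: subgrpMz.
split=> // [x|i|c Nc].
- have [c xc] := gen x; exists c; rewrite -(subrKA (comb b c)).
  by apply: (subgrpD (gN n)) => //; rewrite -opprB; exact: subgrpN.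
- rewrite -(subrK (b i) (b' i)) mulrnDl; apply: (subgrpD (gN n)).
    by apply: (subgrpMn (gN n)); exact: bb'.
  exact: ord_e.
- by apply: rel_e; rewrite -(subKr (comb b' c) (comb b c)); exact: (subgrpB (gN n)).
Qed.

End AdaptedLevels.

Lemma omega_forall_fin (T : finType) (P : T -> set nat) :
  (forall i, omega (P i)) -> omega [set m | forall i, P i m].
Proof.
move=> oP; suff : omega [set m | forall i, i \in enum T -> P i m].
  by apply: (ultraS omega_ultra) => m Pm i; apply: Pm; rewrite mem_enum.
elim: (enum T) => [|i s IH]; first exact: (ultraT omega_ultra).
apply: (ultraS omega_ultra) (ultraI omega_ultra (oP i) IH) => m [Pi Ps] j.
by rewrite in_cons => /orP[/eqP ->|]; [exact: Pi | exact: Ps].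
Qed.

(** Being adapted at level [n] depends only on [b] modulo the open subgroup [p ^ n A], and passes to
    lower levels. The ultralimit of bases adapted at level [m] agrees with almost all of them modulo
    [p ^ n A]. *)
Lemma adapted_limit (A : topologicalZmodType) (p d : nat) (g : 'I_d -> A) :
  compact [set: A] -> prime p -> (forall n, open (multiples (A := A) (p ^ n))) ->
  generates p g 1 -> exists (b : 'I_d -> A) e, forall n, adapted p n b (e n).
Proof.
move=> cA pp oN gen.
have /choice[b_ /choice[e_ beP]] n := adapted_exists pp n gen.
have /choice[b bP] i := omega_lim cA (fun m => b_ m i).
suff /choice[e eP] n : exists e, adapted p n b e by exists b, e.
have bN i : omega [set m | multiples (p ^ n) (b_ m i - b i)].
  apply: (bP i [set y | multiples (p ^ n) (y - b i)]); apply: translate_nbhs.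
  by apply: open_nbhs_nbhs; split=> //; exact: subgrp0 (multiples_subgrp A _).
have [m [/= mb nm]] := ultra_ex omega_ultra
  (ultraI omega_ultra (omega_forall_fin bN) (omega_ge n)).
exists (fun i => minn n (e_ m i)).
apply: adapted_perturb (adapted_le nm (beP m)) => i.
by rewrite -opprB; apply: subgrpN => //; exact: multiples_subgrp.
Qed.

(* 'Z_1 denotes Z/2, hence the hypothesis on q.                               *)
Lemma Zp_intr_eq0 (q : nat) (z : int) : (1 < q)%N ->
  ((z%:~R : 'Z_q) == 0) = (q%:Z %| z)%Z.
Proof.
move=> q1; have natE k : ((k%:R : 'Z_q) == 0) = (q %| k)%N.
  by rewrite -val_eqE /= val_Zp_nat // /dvdn.
case: z => k; first exact: natE.
by rewrite NegzE mulrNz oppr_eq0 natE dvdzE.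
Qed.

Lemma Zp_intr_eq (q : nat) (z w : int) : (1 < q)%N ->
  (z%:~R = w%:~R :> 'Z_q) <-> (q%:Z %| z - w)%Z.
Proof.
move=> q1; rewrite -(Zp_intr_eq0 _ q1) rmorphB subr_eq0.
by split=> [zw|/eqP //]; apply/eqP.
Qed.

Section ImageType.
Variables (A : zmodType) (G : finZmodType) (h : A -> G).
Hypothesis hB : forall x y, h (x - y) = h x - h y.

Definition image_pred : {pred G} := fun y => `[< exists x, h x = y >].

Fact image_zmod_closed : zmod_closed image_pred.
Proof.
split; first by apply/asboolP; exists 0; rewrite -(subrr 0) hB subrr.
move=> y z /asboolP[x <-] /asboolP[x' <-].
by apply/asboolP; exists (x - x').
Qed.

HB.instance Definition _ := GRing.isZmodClosed.Build G image_pred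
  image_zmod_closed.

Definition image_type : Type := {y : G | y \in image_pred}.

HB.instance Definition _ := SubChoice.on image_type.
HB.instance Definition _ := [SubChoice_isSubZmodule of image_type by <:].
HB.instance Definition _ := [Finite of image_type by <:].

(** Replaces the target of the finite coordinate by its image, to make it surjective. *)
Lemma image_factorization : exists (F : finZmodType) (k : A -> F) (v : F -> G),
  [/\ forall x y, k (x - y) = k x - k y, forall z, exists x, k x = z,
      injective v & forall x, v (k x) = h x].
Proof.
have hI x : h x \in image_pred by apply/asboolP; exists x.
exists (image_type : finZmodType), (fun x => exist _ (h x) (hI x)), val; split=> //.
- by move=> x y; apply: val_inj; rewrite /= hB.
- by move=> [y yI]; have /asboolP[x xy] := yI; exists x; apply: val_inj.
Qed.

End ImageType.

(** * The p-adic coordinates *)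

Lemma Zp_reduce (m q : nat) (z : int) : (1 < m)%N -> (1 < q)%N -> (m %| q)%N ->
  (nat_of_ord (z%:~R : 'Z_q))%:R = z%:~R :> 'Z_m.
Proof.
move=> m1 q1 mq; rewrite pmulrn; apply/Zp_intr_eq => //.
apply: (@dvdz_trans q%:Z); first by rewrite dvdzE.
by apply/(Zp_intr_eq _ _ q1); rewrite -pmulrn natr_Zp.
Qed.

Lemma coherent_le (P : primes_type) (f : Zpow_prod P) m n : (m <= n)%N ->
  f \in @coherent P -> f m = (nat_of_ord (f n))%:R :> 'Z_(val P ^ m.+1).
Proof.
have p1 : (1 < val P)%N by exact/prime_gt1/(valP P).
have q1 k : (1 < val P ^ k.+1)%N by rewrite -(exp1n k.+1) ltn_exp2r.
move=> mn /asboolP cf; elim: n mn => [|n IH].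
  by rewrite leqn0 => /eqP ->; rewrite natr_Zp.
rewrite leq_eqVlt => /orP[/eqP ->|]; first by rewrite natr_Zp.
rewrite ltnS => mn; rewrite (IH mn) (cf n).
have dv : (val P ^ m.+1 %| val P ^ n.+1)%N by rewrite dvdn_exp2l.
by have := Zp_reduce (nat_of_ord (f n.+1))%:Z (q1 m) (q1 n) dv; rewrite -!pmulrn.
Qed.

Lemma pgroup_finZmod (F : finZmodType) (p n : nat) : prime p ->
  (forall z : F, z *+ p ^ n = 0) -> (p.-group [set: F]%SET)%g.
Proof.
move=> pp F0; rewrite -pnat_exponent; apply: (@pnat_dvd _ (p ^ n)).
  by apply/exponentP => z _; rewrite FinRing.zmodXgE F0.
by rewrite pnatX pnat_id.
Qed.

(** By [emin], either [e n i = n] for all [n] or [e n i] is eventually constant. In the first case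
    ([Inf]) the coefficients of [x] at [i] are determined modulo every [p ^ n] and form a p-adic
    integer; in the second they are determined modulo a fixed power of [p] and give the finite
    part. *)
Lemma padic_decomposition (A : topologicalZmodType) (P : primes_type) :
  compact [set: A] -> (forall n, open (multiples (A := A) (val P ^ n))) ->
  fin_index (multiples (A := A) (val P)) ->
  exists (alpha : nat) (F : finZmodType) (theta : A -> 'I_alpha -> padic_int P)
    (kappa : A -> F) (L : nat),
  [/\ ((val P).-group [set: F]%SET)%g,
      forall x y j n, val (theta (x - y) j) n =
        (val (theta x j) n : 'Z_(val P ^ n.+1)) - val (theta y j) n,
      forall x y, kappa (x - y) = kappa x - kappa y,
      (forall x j n m, (m <= n)%N -> multiples (val P ^ n.+1) x ->
         val (theta x j) m = (0 : 'Z_(val P ^ m.+1))) /\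
      (forall x, multiples (val P ^ L) x -> kappa x = 0) &
      (forall x, (forall j n, val (theta x j) n = (0 : 'Z_(val P ^ n.+1))) ->
         kappa x = 0 -> forall n, multiples (val P ^ n) x) /\
      (forall (y : 'I_alpha -> padic_int P) z n, exists x, kappa x = z /\
         forall j m, (m <= n)%N -> val (theta x j) m = val (y j) m)].
Proof.
move=> cA oN [s sP]; set p := val P; have pp : prime p := valP P.
have p1 : (1 < p)%N := prime_gt1 pp.
have q1 k : (1 < p ^ k.+1)%N by rewrite -(exp1n k.+1) ltn_exp2r.
pose N n : set A := multiples (p ^ n).
have gN n : subgrp (N n) := multiples_subgrp A (p ^ n).
have Nle m n : (m <= n)%N -> N n `<=` N m by exact: multiples_exp_le.
pose d := size s.
have [b [e bP]] : exists (b : 'I_d -> A) e, forall n, adapted p n b (e n).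
  apply: (@adapted_limit A p d (fun i => nth 0 s i)) => // x.
  have [y ys xy] := sP x; have yd : (index y s < d)%N by rewrite index_mem.
  exists (fun j => (1 *+ (j == Ordinal yd))%:Z).
  by rewrite comb_delta /= nth_index // mulr1n expn1.
have emin m n i : (m <= n)%N -> e m i = minn m (e n i).
  by move=> mn; apply: (adapted_uniq pp (bP m) (adapted_le mn (bP n))).
have le_e n i : (e n i <= n)%N by case: (bP n).
have /choice[c cP] (nx : nat * A) : exists c, N nx.1 (nx.2 - comb b c).
  by case: (bP nx.1) => /(_ nx.2).
have cdvd n x c' i : N n (x - comb b c') -> ((p ^ e n i)%:Z %| c' i - c (n, x) i)%Z.
  move=> Nc'; have [_ _ _ rel] := bP n.
  apply: (rel (fun k => c' k - c (n, x) k)).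
  rewrite -(combB b c').
  have -> : comb b c' - comb b (c (n, x)) = (x - comb b (c (n, x))) - (x - comb b c').
    by rewrite opprB [RHS]addrC subrKA.
  by apply: (subgrpB (gN n)) => //; exact: (cP (n, x)).
pose Inf : {set 'I_d} := [set i | `[< forall n, e n i = n >]]%SET.
have InfE i n : i \in Inf -> e n i = n by rewrite inE => /asboolP.
pose h (j : 'I_#|Inf|) : 'I_d := enum_val j.
have hInf j : h j \in Inf by exact: enum_valP.
(* Component [n] of a p-adic integer is a residue modulo [p ^ n.+1], hence the level [n.+1]. *)
pose raw x j : Zpow_prod P := fun n => (c (n.+1, x) (h j))%:~R : 'Z_(p ^ n.+1).
have rawE x j n c' : N n.+1 (x - comb b c') ->
    raw x j n = (c' (h j))%:~R :> 'Z_(p ^ n.+1).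
  move=> Nc'; have := cdvd _ _ _ (h j) Nc'; rewrite InfE // => dv.
  by apply/esym/(Zp_intr_eq _ _ (q1 n)).
have raw_coh x j : raw x j \in @coherent P.
  apply/asboolP => n; rewrite Zp_reduce ?dvdn_exp2l //; apply: rawE.
  exact: (Nle _ _ (leqnSn n.+1) _ (cP (n.+2, x))).
pose theta x j : padic_int P := exist _ (raw x j) (raw_coh x j).
have [L0 stable] : exists L, forall i n, i \notin Inf -> (L <= n)%N ->
    e n i = e L i.
  have /choice[m mP] i : exists m, i \notin Inf -> e m i <> m.
    have [iI|] := boolP (i \in Inf); first by exists 0%N.
    by rewrite inE => /asboolPn/existsNP[m]; exists m.
  have small i n : i \notin Inf -> (m i <= n)%N -> e n i = e (m i) i.
    move=> /mP eim mn; move: eim; rewrite (emin _ _ _ mn) /minn.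
    by case: ltnP.
  exists (\max_i m i)%N => i n iI Ln.
  have mL : (m i <= \max_i m i)%N by exact: leq_bigmax.
  by rewrite (small _ n) ?(small _ (\max_i m i)%N) // (leq_trans mL).
(* [L] must be positive, since ['Z_1] is not the trivial ring. *)
pose L := L0.+1.
have {}stable i n : i \notin Inf -> (L <= n)%N -> e n i = e L i.
  move=> iI Ln; rewrite (stable i n iI) ?(stable i L iI) //; exact: ltnW.
pose G : finZmodType := 'rV['Z_(p ^ L)]_d.
(* Multiplication by [w i] embeds Z / p ^ (e L i) into Z / p ^ L, so that all finite coordinates
   share one type. *)
pose w i := (p ^ (L - e L i))%:Z.
pose row c' : G := \row_i (if i \in Inf then 0 else (c' i * w i)%:~R).
pose hk x : G := row (c (L, x)).
have pL i : (p ^ L)%:Z = (p ^ e L i)%:Z * w i.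
  by rewrite -PoszM -expnD subnKC.
have w0 i : w i != 0 by rewrite /w -lt0n expn_gt0 ltnW.
have hkE x c' : N L (x - comb b c') -> hk x = row c'.
  move=> Nc; apply/rowP => i; rewrite !mxE; case: ifP => // _.
  apply/esym/(Zp_intr_eq _ _ (q1 L0)); rewrite -mulrBl (pL i).
  by rewrite dvdz_mul2r //; exact: cdvd.
have relB n x y c' c'' : N n (x - comb b c') -> N n (y - comb b c'') ->
    N n (x - y - comb b (fun i => c' i - c'' i)).
  move=> Nc' Nc''; rewrite -combB; have := subgrpB (gN n) Nc' Nc''.
  by rewrite !opprD !opprK addrACA.
have hkB x y : hk (x - y) = hk x - hk y.
  rewrite (hkE _ _ (relB _ _ _ _ _ (cP (L, x)) (cP (L, y)))).
  apply/rowP => i; rewrite !mxE; case: ifP => _; first by rewrite subr0.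
  by rewrite mulrBl rmorphB.
have hk0 : hk 0 = 0 by rewrite -(subrr (0 : A)) hkB subrr.
have [F [k [v [kB ksurj vI vk]]]] := image_factorization hkB.
have k0 : k 0 = 0 by rewrite -(subrr (0 : A)) kB subrr.
have comb0 : comb b (fun=> 0) = 0.
  by rewrite /comb big1 // => i _; rewrite mulr0z.
have kL x : N L x -> k x = 0.
  move=> NLx; rewrite -k0; apply: vI; rewrite !vk hk0.
  rewrite (hkE x (fun=> 0)); last by rewrite comb0 subr0.
  by apply/rowP => i; rewrite !mxE mul0r if_same.
exists #|Inf|, F, theta, k, L; split=> //.
- apply: (@pgroup_finZmod F p L pp) => z; have [x <-] := ksurj z.
  have [k' k'E] := additive_of_sub kB.
  by rewrite -k'E -raddfMn k'E kL //; exists x.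
- move=> x y j n.
  rewrite [LHS](rawE _ _ _ _ (relB _ _ _ _ _ (cP (n.+1, x)) (cP (n.+1, y)))).
  by rewrite rmorphB.
- split=> // x j n m mn Nx; rewrite [LHS](rawE _ _ _ (fun=> 0)) //.
  by rewrite comb0 subr0; exact: (Nle m.+1 n.+1).
split=> [x th0 kx0 n0|y z n].
  suff big n : (L <= n)%N -> N n x.
    by apply: (Nle _ _ (leq_maxl n0 L)); apply: big; exact: leq_maxr.
  case: n => // n Ln; rewrite -(subrK (comb b (c (n.+1, x))) x).
  apply: (subgrpD (gN n.+1)); first exact: (cP (n.+1, x)).
  apply: (subgrp_sum (gN n.+1)) => i _.
  suff /dvdzP[z ->] : ((p ^ e n.+1 i)%:Z %| c (n.+1, x) i)%Z.
    rewrite mulrC mulrzA; apply: (subgrpMz (gN n.+1)).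
    by have [_ _ + _] := bP n.+1; apply.
  have [iI|iI] := boolP (i \in Inf).
    rewrite InfE //; have := th0 (enum_rank_in iI i) n.
    rewrite [val _ _](_ : _ = (c (n.+1, x) i)%:~R); last first.
      by rewrite /= /raw /h enum_rankK_in.
    by move=> /eqP; rewrite Zp_intr_eq0.
  rewrite (stable _ _ iI Ln).
  have : hk x = 0 by rewrite -vk kx0 -k0 vk hk0.
  rewrite (hkE x (c (n.+1, x))); last exact: (Nle _ _ Ln _ (cP (n.+1, x))).
  move=> /rowP/(_ i); rewrite !mxE (negPf iI) => /eqP.
  by rewrite (Zp_intr_eq0 _ (q1 L0)) (pL i) dvdz_mul2r.
have [x0 <-] := ksurj z.
(* Coefficients prescribed by [y] on [Inf], and those of a preimage [x0] of [z] elsewhere. *)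
pose c' i := if [pick j | h j == i] is Some j
  then (nat_of_ord (val (y j) n))%:Z else c (L, x0) i.
exists (comb b c').
have Nc' m : N m (comb b c' - comb b c') by rewrite subrr; exact: subgrp0.
split=> [|j m mn].
  apply: vI; rewrite !vk (hkE _ _ (Nc' L)); apply/rowP => i; rewrite !mxE.
  case: ifP => // /negP iI; congr ((_ * _)%:~R); rewrite /c'.
  by case: pickP => // j /eqP hj; case: iI; rewrite -hj.
rewrite [LHS](rawE _ _ _ _ (Nc' m.+1)) /c'.
case: pickP => [j' /eqP /enum_val_inj ->|/(_ j)]; last by rewrite eqxx.
by rewrite -pmulrn -coherent_le //; exact: (valP (y j)).
Qed.

(** * Multiples in compact groups and coprime moduli *)

Section MultiplesTopology.
Variable A : topologicalZmodType.
Hypothesis cA : compact [set: A].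

Lemma fin_index_open (S : set A) :
  subgrp S -> closed S -> fin_index S -> open S.
Proof.
move=> gS cS [s sP]; rewrite -[S]setCK; apply: closed_openC.
have -> : ~` S = \bigcup_(y in [set` [seq y <- s | `[< ~ S y >]]]) [set x | S (x - y)].
  apply/seteqP; split=> [x nSx|x [y]].
    have [y ys Sxy] := sP x; exists y => //=.
    rewrite mem_filter ys andbT; apply/asboolP => Sy; apply: nSx.
    by rewrite -(subrK y x); exact: subgrpD.
  rewrite /= mem_filter => /andP[/asboolP nSy _] Sxy Sx; apply: nSy.
  by rewrite -(subKr x y); exact: subgrpB.
apply: closed_bigcup; first exact: finite_seq.
by move=> y _; exact: translate_closed.
Qed.

Lemma mulrn_continuous p : continuous (fun x : A => x *+ p).
Proof.
elim: p => [|p IH]; first exact: cst_continuous.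
rewrite (_ : (fun x : A => _) = fun x => x *+ p - - x); last first.
  by apply/funext => x; rewrite opprK mulrSr.
by apply: continuousB_zmod => //; exact: opp_continuous.
Qed.

Lemma multiples_closed p : hausdorff_space A -> closed (multiples (A := A) p).
Proof.
move=> hA; have -> : multiples p = (fun x : A => x *+ p) @` setT.
  by apply/seteqP; split=> [_ [y ->]|_ [y _ <-]]; exists y.
apply: compact_closed => //; apply: continuous_compact => //.
exact/continuous_subspaceT/mulrn_continuous.
Qed.

Lemma fin_index_multiples_exp p n : fin_index (multiples (A := A) p) ->
  fin_index (multiples (A := A) (p ^ n)).
Proof.
move=> [s sP]; elim: n => [|n [t tP]].
  by exists [:: 0] => x; exists 0; [exact: mem_head | exists (x - 0); rewrite mulr1n].
exists [seq y + z *+ p ^ n | y <- t, z <- s] => x.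
have [y yt [x' xE]] := tP x; have [z zs [x'' x'E]] := sP x'.
exists (y + z *+ p ^ n); first by apply/allpairsP; exists (y, z).
by exists x''; rewrite opprD addrA xE -mulrnBl x'E -mulrnA expnS.
Qed.

Lemma open_multiples_exp p n : hausdorff_space A ->
  fin_index (multiples (A := A) p) -> open (multiples (A := A) (p ^ n)).
Proof.
move=> hA /(fin_index_multiples_exp n); apply: fin_index_open.
  exact: multiples_subgrp.
exact: multiples_closed.
Qed.

(** Each of finitely many representatives has two multiples in one coset of [S], hence a positive
    multiple in [S]; the product of the multipliers works for all. *)
Lemma open_subgrp_multiples (S : set A) : subgrp S -> open S ->
  exists2 m, (0 < m)%N & multiples m `<=` S.
Proof.
move=> gS oS; have [s sP] := open_subgrp_fin_index cA gS oS.
have [m m0 mP] : exists2 m, (0 < m)%N & forall y, y \in s -> S (y *+ m).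
  elim: {sP} s => [|y s [m m0 mP]]; first by exists 1%N.
  have [k [l [kl Sy]]] := open_no_spread cA (fun k => y *+ k) gS oS.
  exists (m * (l - k))%N; first by rewrite muln_gt0 m0 subn_gt0.
  move=> z; rewrite in_cons => /orP[/eqP ->|/mP Sz]; last first.
    by rewrite mulrnA; exact: subgrpMn.
  by rewrite mulnC mulrnA mulrnBr ?(ltnW kl) //; exact: subgrpMn.
exists m => // _ [x ->]; have [y ys Sxy] := sP x.
by rewrite -(subrK y x) mulrnDl; apply: subgrpD; [|exact: subgrpMn|exact: mP].
Qed.

End MultiplesTopology.

Lemma multiples_coprime (A : zmodType) (a b : nat) (x : A) : coprime a b ->
  multiples a x -> multiples b x -> multiples (a * b) x.
Proof.
move=> cab [y xy] [z xz]; have [u [v uv]] := Bezoutz a b.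
have {}uv : u * a%:Z + v * b%:Z = 1 by rewrite uv /gcdz /= (eqP cab).
exists (z *~ u + y *~ v); rewrite mulrnDl.
rewrite -{1}(mulr1z x) -uv mulrzDr; congr (_ + _).
  by rewrite {1}xz !pmulrn -!mulrzA PoszM; congr (_ *~ _); rewrite mulrCA (mulrC b%:Z).
by rewrite {1}xy !pmulrn -!mulrzA PoszM; congr (_ *~ _); rewrite mulrCA.
Qed.

Lemma multiples_all (A : zmodType) (x : A) :
  (forall p n, prime p -> multiples (p ^ n) x) ->
  forall m, (0 < m)%N -> multiples m x.
Proof.
move=> xP; elim/ltn_ind => m IH m0.
have [m1|m1] := leqP m 1.
  have -> : m = 1%N by apply/eqP; rewrite eqn_leq m1.
  by exists x; rewrite mulr1n.
have pp := pdiv_prime m1; have [r rp mE] := pfactor_coprime pp m0.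
rewrite mE; apply: multiples_coprime; last exact: xP.
  by rewrite coprime_sym coprimeXl.
have r0 : (0 < r)%N by move: m0; rewrite {1}mE muln_gt0 => /andP[].
apply: IH => //; rewrite [ltnRHS]mE -{1}(muln1 r) ltn_pmul2l //.
by rewrite -(expn0 (pdiv m)) ltn_exp2l ?prime_gt1 // logn_gt0 mem_primes pp m0 pdiv_dvd.
Qed.

(** With [u q + v p ^ n = 1], adding [u q (a p - x)] moves [x] to [a p] modulo [p ^ n] and does not
    change it modulo the other [r ^ n], which divide [q]. *)
Lemma multiples_crt (A : zmodType) (s : seq nat) (n : nat) (a : nat -> A) :
  uniq s -> all prime s ->
  exists x, forall p, p \in s -> multiples (p ^ n) (x - a p).
Proof.
elim: s => [|p s IH]; first by exists 0.
move=> /= /andP[ps us] /andP[pp sp]; have [x xP] := IH us sp.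
pose q := (\prod_(r <- s) r ^ n)%N.
have cqp : coprime q (p ^ n).
  apply: coprimeXr; rewrite /q big_seq; elim/big_ind: _ => [|k l kp lp|r rs].
  - exact: coprime1n.
  - by rewrite coprimeMl kp.
  - have pr := allP sp r rs.
    apply: coprimeXl; rewrite prime_coprime // dvdn_prime2 //.
    by apply: contraNneq ps => <-.
have [u [v uv]] := Bezoutz q (p ^ n)%N.
have {}uv : u * q%:Z + v * (p ^ n)%:Z = 1 by rewrite uv /gcdz /= (eqP cqp).
exists (x + (a p - x) *~ (u * q%:Z)) => r; rewrite in_cons => /orP[/eqP ->|rs].
  exists ((x - a p) *~ v); rewrite pmulrn -mulrzA.
  have -> : v * (p ^ n)%:Z = 1 - u * q%:Z by rewrite -uv addrC addKr.
  by rewrite mulrzBr mulr1z -(opprB x) mulNrz addrAC.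
rewrite addrAC; apply: (subgrpD (multiples_subgrp A (r ^ n))); first exact: xP.
apply: (@multiples_dvd A (r ^ n) q); first by rewrite /q (big_rem r) //= dvdn_mulr.
by exists ((a p - x) *~ u); rewrite pmulrn -mulrzA.
Qed.

(** * Gluing the primes; the two cases *)

Lemma open_forall_fin (T : topologicalType) (J : finType) (S : J -> set T) :
  (forall j, open (S j)) -> open [set x | forall j, S j x].
Proof.
move=> oS; rewrite (_ : mkset _ = [set x | forall k, (k < #|J|)%N ->
    forall j, enum_rank j = k :> nat -> S j x]); last first.
  apply/seteqP; split=> x Sx // j; exact: (Sx (enum_rank j)).
apply: (@open_forall_ltn T #|J|
  (fun k => [set x | forall j, enum_rank j = k :> nat -> S j x])) => k kJ.
rewrite (_ : mkset _ = S (enum_val (Ordinal kJ))) //.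
apply/seteqP; split=> x Sx; first by apply: Sx; rewrite enum_valK.
by move=> j jk; rewrite (_ : j = enum_val (Ordinal kJ)) // -[LHS]enum_rankK;
  congr enum_val; exact: val_inj.
Qed.

(** Bundles the data of [padic_decomposition], so that a choice for all primes is one dependent
    function. *)
Record padic_coordinates (A : topologicalZmodType) (P : primes_type) :=
    PadicCoordinates {
  padic_rank : nat;
  finite_part : finZmodType;
  padic_coord : A -> 'I_padic_rank -> padic_int P;
  finite_coord : A -> finite_part;
  finite_level : nat;
  finite_part_pgroup : ((val P).-group [set: finite_part]%SET)%g;
  padic_coordB : forall x y j n, val (padic_coord (x - y) j) n =
    (val (padic_coord x j) n : 'Z_(val P ^ n.+1)) - val (padic_coord y j) n;
  finite_coordB : forall x y,
    finite_coord (x - y) = finite_coord x - finite_coord y;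
  padic_coord0 : forall x j n m, (m <= n)%N -> multiples (val P ^ n.+1) x ->
    val (padic_coord x j) m = (0 : 'Z_(val P ^ m.+1));
  finite_coord0 : forall x, multiples (val P ^ finite_level) x ->
    finite_coord x = 0;
  coord_eq0 : forall x,
    (forall j n, val (padic_coord x j) n = (0 : 'Z_(val P ^ n.+1))) ->
    finite_coord x = 0 -> forall n, multiples (val P ^ n) x;
  coord_dense : forall (y : 'I_padic_rank -> padic_int P) z n, exists x,
    finite_coord x = z /\
    forall j m, (m <= n)%N -> val (padic_coord x j) m = val (y j) m }.

Arguments padic_coord {A P} _ _ _.
Arguments finite_coord {A P} _ _.
Arguments padic_coord0 {A P} _ {x} j {n m} _ _.
Arguments coord_dense {A P} _ _ _ _.

(** An element with all coordinates zero lies in [p ^ n A] for all [p] and [n], hence in [mA] for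
    all positive [m], hence in every open subgroup. For density, only the primes up to [n] matter
    modulo [S n], and approximations at these are combined by [multiples_crt]. *)
Lemma product_decomposition (A : topologicalZmodType) : profinite A ->
  (forall p, prime p -> fin_index (multiples (A := A) p)) ->
  exists (alpha : primes_type -> nat) (F : primes_type -> finZmodType),
    (forall p : primes_type, ((val p).-group [set: F p]%SET)%g) /\
    top_isom A
      (prod_topology (fun p : primes_type =>
         pair_group (prod_topology (fun _ : 'I_(alpha p) => padic_int p))
                    (discrete_topology (F p)))).
Proof.
move=> [cA hA tdA] finp.
have oN (P : primes_type) n : open (multiples (A := A) (val P ^ n)).
  by apply: open_multiples_exp => //; exact: finp (valP P).
have D (P : primes_type) : padic_coordinates A P.
  suff /cid[] : exists _ : padic_coordinates A P, True by [].
  have [alpha [F [th [ka [L [pF thB kaB [th0 ka0] [eq0 dense]]]]]]] :=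
    padic_decomposition cA (oN P) (finp _ (valP P)).
  by exists (PadicCoordinates pF thB kaB th0 ka0 eq0 dense).
exists (fun P => padic_rank (D P)), (fun P => finite_part (D P)).
split=> [P|]; first exact: finite_part_pgroup.
pose C := prod_topology (fun p : primes_type =>
  pair_group (prod_topology (fun _ : 'I_(padic_rank (D p)) => padic_int p))
             (discrete_topology (finite_part (D p)))).
pose f (x : A) : C := fun P => (padic_coord (D P) x, finite_coord (D P) x).
pose vanish n P (y : C) := (y P).2 = 0 /\
  forall j m, (m < n.+1)%N -> val ((y P).1 j) m = (0 : 'Z_(val P ^ m.+1)).
pose S n : set C := [set y | forall P, (val P < n.+1)%N -> vanish n P y].
have fB x y : f (x - y) = f x - f y.
  apply/functional_extensionality_dep => P.
  rewrite -[RHS]/((f x P).1 - (f y P).1, (f x P).2 - (f y P).2) /=.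
  congr pair; last exact: finite_coordB.
  apply/functional_extensionality_dep => j; apply: val_inj.
  by apply/functional_extensionality_dep => n; exact: padic_coordB.
have gN (P : primes_type) n := multiples_subgrp A (val P ^ n).
have fc : continuous f.
  apply: continuous_to_prod => P x.
  apply: (@cvg_pair _ _ _ _ (nbhs ((f x P).1)) (nbhs ((f x P).2))).
    move: x; apply: continuous_to_prod => j.
    apply: (@continuous_comp_initial _ _ _ (val : padic_int P -> Zpow_prod P)).
    apply: continuous_to_prod => n.
    apply: (@continuous_to_discrete A 'Z_(val P ^ n.+1) _
      (multiples (val P ^ n.+1))) => //.
    - by move=> x y; exact: padic_coordB.
    - by move=> x Nx; exact: (padic_coord0 (D P) j (leqnn n) Nx).
  move: x; apply: (@continuous_to_discrete A (finite_part (D P)) _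
    (multiples (val P ^ finite_level (D P)))) => //.
  - by move=> x y; exact: finite_coordB.
  - by move=> x; exact: finite_coord0.
have cP P : continuous (fun y : C => y P) by exact: prod_proj_continuous.
have c2 P : continuous (fun y : C => (y P).2).
  by move=> y; apply: (@continuous_comp _ _ _ (fun y : C => y P) snd);
    [exact: cP | exact: cvg_snd].
have c1 P j m : continuous (fun y : C => val ((y P).1 j) m).
  pose T := prod_topology (fun _ : 'I_(padic_rank (D P)) => padic_int P).
  have cval : continuous (fun u : padic_int P => val u m).
    move=> u; apply: (@continuous_comp (padic_int P) (Zpow_prod P)
      (discrete_topology 'Z_(val P ^ m.+1)) (val : padic_int P -> Zpow_prod P)
      (fun w => w m)).
      exact: initial_continuous.
    exact: prod_proj_continuous.
  have cj : continuous (fun u : T => val (u j) m).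
    move=> u; apply: (@continuous_comp T (padic_int P)
      (discrete_topology 'Z_(val P ^ m.+1)) (fun w : T => w j)
      (fun w : padic_int P => val w m)); last exact: cval.
    exact: prod_proj_continuous.
  pose T2 := pair_group T (discrete_topology (finite_part (D P))).
  have cfst : continuous (fun u : T2 => val (u.1 j) m).
    move=> u; apply: (@continuous_comp T2 T (discrete_topology 'Z_(val P ^ m.+1))
      fst (fun w : T => val (w j) m)); [exact: cvg_fst | exact: cj].
  move=> y; apply: (@continuous_comp C T2 (discrete_topology 'Z_(val P ^ m.+1))
    (fun y : C => y P) (fun u : T2 => val (u.1 j) m)); [exact: cP | exact: cfst].
have ovanish n P : open (vanish n P).
  rewrite (_ : vanish n P = [set y : C | (y P).2 = 0] `&`
    [set y : C | forall j m, (m < n.+1)%N ->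
       val ((y P).1 j) m = (0 : 'Z_(val P ^ m.+1))]) //.
  apply: openI.
    apply: (@open_comp _ _ (fun y : C => (y P).2) [set 0]); last exact: discrete_open.
    by move=> y _; exact: c2.
  apply: (@open_forall_fin C _ (fun j => [set y : C | forall m, (m < n.+1)%N ->
    val ((y P).1 j) m = (0 : 'Z_(val P ^ m.+1))])) => j.
  apply: (@open_forall_ltn C n.+1 (fun m => [set y : C |
    val ((y P).1 j) m = (0 : 'Z_(val P ^ m.+1))])) => m _.
  apply: (@open_comp _ _ (fun y : C => val ((y P).1 j) m) [set (0 : 'Z_(val P ^ m.+1))]);
    last exact: discrete_open.
  by move=> y _; exact: c1.
apply: (@compact_dense_iso A C f S) => //.
- move=> x fx0; apply: contrapT => x0.
  have [U [gU oU]] := open_subgrp_separates cA hA tdA x0; apply.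
  have [m m0 mU] := open_subgrp_multiples cA gU oU; apply: mU.
  apply: multiples_all => // p n pp.
  pose P : primes_type := exist _ p pp.
  have fP : f x P = 0 by rewrite fx0.
  apply: (@coord_eq0 A P (D P) x).
    by move=> j k; rewrite -[padic_coord (D P) x]/((f x P).1) fP.
  by rewrite -[finite_coord (D P) x]/((f x P).2) fP.
- move=> n; split=> [P _|y z Sy Sz P Pn]; first by split.
  have [y2 y1] := Sy P Pn; have [z2 z1] := Sz P Pn; split=> [|j m mn].
    by rewrite -[LHS]/((y P).2 - (z P).2) y2 z2 subr0.
  rewrite -[LHS]/((val ((y P).1 j) m : 'Z_(val P ^ m.+1)) - val ((z P).1 j) m).
  by rewrite y1 // z1 // subr0.
- move=> n; rewrite /S (_ : mkset _ = [set y : C | forall k, (k < n.+1)%N ->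
      forall P, val P = k -> vanish n P y]); last first.
    apply/seteqP; split=> [y Sy k kn P Pk|y Sy P Pn]; last exact: (Sy (val P)).
    by apply: Sy; rewrite Pk.
  apply: (@open_forall_ltn C n.+1 (fun k => [set y : C |
    forall P, val P = k -> vanish n P y])) => k _.
  have [pk|npk] := pselect (prime k).
    rewrite (_ : mkset _ = vanish n (exist _ k pk)) //.
    apply/seteqP; split=> y; first by apply.
    by move=> vy P Pk; rewrite (_ : P = exist _ k pk) //; exact: val_inj.
  rewrite (_ : mkset _ = setT); first exact: openT.
  by apply/seteqP; split=> // y _ P Pk; case: npk; rewrite -Pk; exact: (valP P).
- move=> m n; rewrite -ltnS => mn y Sy P Pm.
  have [y2 y1] := Sy P (leq_trans Pm mn); split=> // j k km.
  exact: (y1 j k (leq_trans km mn)).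
- move=> y Sy; apply/functional_extensionality_dep => P.
  have y2 : (y P).2 = 0 by case: (Sy (val P) P).
  have y1 : (y P).1 = 0.
    apply/functional_extensionality_dep => j; apply: val_inj.
    apply/functional_extensionality_dep => m.
    have [] := Sy (maxn (val P) m) P; first by rewrite ltnS leq_maxl.
    by move=> _; apply; rewrite ltnS leq_maxr.
  by rewrite (surjective_pairing (y P)) y1 y2.
move=> y n.
(* [a] and [L] are indexed by numbers, with junk values at non-primes, to suit [multiples_crt] and
   the maximum in [M]. *)
have /choice[a aP] (p : nat) : exists x, forall P : primes_type, val P = p ->
    finite_coord (D P) x = (y P).2 /\
    forall j m, (m <= n)%N -> val (padic_coord (D P) x j) m = val ((y P).1 j) m.
  have [pp|npp] := pselect (prime p).
    have [x xP] := coord_dense (D (exist _ p pp)) (y (exist _ p pp)).1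
      (y (exist _ p pp)).2 n.
    by exists x => P Pp; rewrite (_ : P = exist _ p pp) //; exact: val_inj.
  by exists 0 => P Pp; case: npp; rewrite -Pp; exact: (valP P).
have /choice[L LP] (p : nat) : exists k, forall P : primes_type, val P = p ->
    finite_level (D P) = k.
  have [pp|npp] := pselect (prime p).
    exists (finite_level (D (exist _ p pp))) => P Pp.
    by rewrite (_ : P = exist _ p pp) //; exact: val_inj.
  by exists 0%N => P Pp; case: npp; rewrite -Pp; exact: (valP P).
(* A level sufficient for [n.+1] p-adic components and for the finite parts at all primes up to
   [n]. *)
pose M := (n.+1 + \max_(p < n.+1) L p)%N.
have [|x xP] := @multiples_crt A [seq p <- iota 0 n.+1 | prime p] M a
  (filter_uniq _ (iota_uniq _ _)); first exact: filter_all.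
exists x => P Pn.
have Nx : multiples (val P ^ M) (x - a (val P)).
  by apply: xP; rewrite mem_filter (valP P) mem_iota.
have [a2 a1] := aP (val P) P erefl; split.
  rewrite -[LHS]/(finite_coord (D P) x - (y P).2) -a2 -finite_coordB.
  apply: finite_coord0; apply: multiples_exp_le Nx; rewrite (LP (val P)) // /M.
  apply: leq_trans (leq_addl _ _).
  exact: (leq_bigmax (Ordinal Pn) : (L (Ordinal Pn) <= _)%N).
move=> j m mn; rewrite -[LHS]/((val (padic_coord (D P) x j) m : 'Z_(val P ^ m.+1)) -
  val ((y P).1 j) m) -a1 // -padic_coordB.
apply: (padic_coord0 (D P) j (n := n)) => //.
by apply: multiples_exp_le Nx; exact: leq_addr.
Qed.

(** If some [K i] is small modulo [pA], then [pA] has finite index because [K i] has. Otherwise [pA]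
    is small modulo every [K i], hence finite; then some [K i] meets it only in 0, and [p K i] lies
    in both. *)
Lemma multiples_dichotomy (A : topologicalZmodType) (I : Type)
    (K : I -> zmodClosed A) (p : nat) :
  profinite A -> fundamental_system K ->
  group_sort_dp_rank1 (theory_of (prof_struct_of K)) ->
  fin_index (multiples (A := A) p) \/ exists i, forall x, x \in K i -> x *+ p = 0.
Proof.
move=> profA fundK dpK; have [cA _ _] := profA.
have gN := multiples_subgrp A p.
have [n nP] := dp_multiples_bound dpK p.
have [[i nKi]|allK] := pselect (exists i,
    ~ big_index n [set` K i] (multiples (A := A) p)).
  left; have [s [_ sP]] := not_big_index gN nKi.
  have oK : open [set` K i] by case: fundK.
  have [t tP] := open_subgrp_fin_index cA (zmodClosed_subgrp (K i)) oK.
  exists [seq y + z | y <- t, z <- s] => x.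
  have [y yt /sP[z zs xyz]] := tP x.
  by exists (y + z); [apply/allpairsP; exists (y, z) | rewrite opprD addrA].
right; have [s sP] : exists s : seq A, forall x, multiples p x -> x \in s.
  apply: contrapT => /(infinite_big_index profA fundK n)[j jP].
  by case: (nP j) => // nKj; apply: allK; exists j.
have [i iP] := fundamental_separates profA fundK s.
exists i => x Kx; apply: iP; last exact: rpredMn.
by apply: sP; exists x.
Qed.

Theorem theorem3p4 (A : topologicalZmodType) (I : Type) (K : I -> zmodClosed A)
    (profA : profinite A) (fundK : fundamental_system K)
    (dpA : dp_minimal (prof_struct_of K)) :
  (exists (U : zmodClosed A) (p : nat),
     [/\ open [set` U], prime p &
         top_isom (subgroup_type U)
           (prod_topology (fun _ : nat => discrete_topology 'F_p))]) \/
  (exists (alpha : primes_type -> nat) (F : primes_type -> finZmodType),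
     (forall p : primes_type, ((val p).-group [set: F p]%SET)%g) /\
     top_isom A
       (prod_topology (fun p : primes_type =>
          pair_group (prod_topology (fun _ : 'I_(alpha p) => padic_int p))
                     (discrete_topology (F p))))).
Proof.
have [_ dpK] := dpA; have [cA _ _] := profA.
have [|nfin] := pselect (forall p, prime p -> fin_index (multiples (A := A) p)).
  by move=> finp; right; exact: product_decomposition.
left; have [p /not_implyP[pp nfinp]] := (existsNP _).2 nfin.
have [//|[i pK]] := multiples_dichotomy p profA fundK dpK.
(* A list of all elements of [A] would also represent it modulo [pA]. *)
have infA : ~ exists s : seq A, forall x, x \in s.
  move=> [s sP]; apply: nfinp; exists s => x; exists x => //.
  by rewrite subrr; exact: subgrp0 (multiples_subgrp A p).
have oK j : open [set` K j] by case: fundK.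
have [n nP] := dp_fundamental_bound dpK.
have [u uP] := countable_fundamental profA fundK infA nP.
exists (K i), p; split=> //.
apply: (@elementary_abelian_isom A (K i) p cA (oK i) pp pK _
  (fun m => [set` K (u m)])) => // [|m].
- exact: (open_subgrp_infinite profA infA (zmodClosed_subgrp (K i)) (oK i)).
- exact: zmodClosed_subgrp.
Qed.
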